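(* Let $\Phi:\{0,1\}^\omega\to\{0,1\}^\omega$ be a computable injection. If $X\in\{0,1\}^\omega$ is computably random (with respect to the uniform measure $\mu$), then $\Phi(X)$ is computably random with respect to the measure $\mu\circ\Phi^{-1}$, i.e. no computable $\Phi$-martingale succeeds on $\Phi(X)$.
   Context: $\mu$ is the uniform measure; $X$ is computably random if no computable martingale ($m(\sigma0)+m(\sigma1)=2m(\sigma)$, values uniformly computable reals) satisfies $\limsup_n m(X\upharpoonright n)=\infty$. A $\Phi$-martingale is a function $b:\{0,1\}^{<\omega}\to\mathbb{R}_{\ge0}$ with $b(\tau)\mu(\Phi^{-1}[\tau])=b(\tau0)\mu(\Phi^{-1}[\tau0])+b(\tau1)\mu(\Phi^{-1}[\tau1])$ for all $\tau$; it is computable if $b(\tau)$ is a computable real uniformly in $\tau$, and it succeeds on $Y$ if $\limsup_n b(Y\upharpoonright n)=\infty$. Computable randomness of $Y$ with respect to $\mu\circ\Phi^{-1}$ means no computable $\Phi$-martingale succeeds on $Y$. *)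

(* Defs.v *)
From Stdlib Require Import Reals Lra Lia ZArith List ClassicalEpsilon.
Import ListNotations.
Open Scope R_scope.

Definition cantor := nat -> bool.
Definition bstring := list bool.

Definition restr (X : cantor) (n : nat) : bstring := map X (seq 0 n).

Definition is_prefix (s : bstring) (Y : cantor) : Prop :=
  forall i, (i < length s)%nat -> nth i s false = Y i.

Fixpoint all_strings (n : nat) : list bstring :=
  match n with
  | O => [ [] ]
  | S k => flat_map (fun s => [s ++ [false]; s ++ [true]]) (all_strings k)
  end.

Definition inner_approx (A : cantor -> Prop) (n : nat) : R :=
  fold_right Rplus 0
    (map (fun s => if excluded_middle_informative
                        (forall X, is_prefix s X -> A X) then 1 else 0)
         (all_strings n)) / 2 ^ n.

(* mu(A) for open A: the supremum of the inner approximations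
   (which is the uniform measure of A for every open set A). *)
Definition mu_open (A : cantor -> Prop) : R :=
  epsilon (inhabits 0)
    (fun r => is_lub (fun x => exists n, x = inner_approx A n) r).

Definition preimage_cyl (Phi : cantor -> cantor) (tau : bstring) : cantor -> Prop :=
  fun X => is_prefix tau (Phi X).

Definition mu_pre (Phi : cantor -> cantor) (tau : bstring) : R :=
  mu_open (preimage_cyl Phi tau).

Inductive prf : Type :=
| PZero : prf
| PSucc : prf
| PProj : nat -> prf
| PComp : prf -> list prf -> prf
| PPrim : prf -> prf -> prf
| PMu   : prf -> prf.

Inductive eval : prf -> list nat -> nat -> Prop :=
| ev_zero : forall a, eval PZero a 0
| ev_succ : forall a, eval PSucc a (S (hd 0%nat a))
| ev_proj : forall i a, eval (PProj i) a (nth i a 0%nat)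
| ev_comp : forall f gs a ys y,
    evals gs a ys -> eval f ys y -> eval (PComp f gs) a y
| ev_prim0 : forall f g a y, eval f a y -> eval (PPrim f g) (0%nat :: a) y
| ev_primS : forall f g n a r y,
    eval (PPrim f g) (n :: a) r -> eval g (n :: r :: a) y ->
    eval (PPrim f g) (S n :: a) y
| ev_mu : forall f a n,
    eval f (n :: a) 0 ->
    (forall m, (m < n)%nat -> exists k, k <> 0%nat /\ eval f (m :: a) k) ->
    eval (PMu f) a n
with evals : list prf -> list nat -> list nat -> Prop :=
| evs_nil : forall a, evals [] a []
| evs_cons : forall g gs a y ys,
    eval g a y -> evals gs a ys -> evals (g :: gs) a (y :: ys).

(* bijective coding of binary strings by natural numbers *)
Fixpoint code_bs (s : bstring) : nat :=
  match s with
  | [] => 0%nat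
  | b :: t => (2 * code_bs t + (if b then 2 else 1))%nat
  end.

Definition code_Z (z : Z) : nat :=
  match z with
  | Z0 => 0%nat
  | Zpos p => (2 * Pos.to_nat p)%nat
  | Zneg p => (2 * Pos.to_nat p - 1)%nat
  end.

Definition computable_bs_fun (g : bstring -> bstring) : Prop :=
  exists p, forall s, eval p [code_bs s] (code_bs (g s)).

Definition computable_functional (Phi : cantor -> cantor) : Prop :=
  exists g : bstring -> bstring, computable_bs_fun g /\
    forall X : cantor,
      (forall m, is_prefix (g (restr X m)) (Phi X)) /\
      (forall n, exists m, (n <= length (g (restr X m)))%nat).

Definition computable_real_fun (b : bstring -> R) : Prop :=
  exists (q : bstring -> nat -> Z) (p : prf),
    (forall s k, eval p [code_bs s; k] (code_Z (q s k))) /\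
    (forall s k, Rabs (b s - IZR (q s k) / 2 ^ k) <= / 2 ^ k).

Definition martingale (m : bstring -> R) : Prop :=
  (forall s, 0 <= m s) /\
  (forall s, m (s ++ [false]) + m (s ++ [true]) = 2 * m s).

Definition succeeds (b : bstring -> R) (Y : cantor) : Prop :=
  forall M : R, forall N : nat, exists n, (N <= n)%nat /\ M < b (restr Y n).

Definition computably_random (X : cantor) : Prop :=
  forall m, martingale m -> computable_real_fun m -> ~ succeeds m X.

Definition Phi_martingale (Phi : cantor -> cantor) (b : bstring -> R) : Prop :=
  (forall t, 0 <= b t) /\
  (forall t, b t * mu_pre Phi t =
             b (t ++ [false]) * mu_pre Phi (t ++ [false])
             + b (t ++ [true]) * mu_pre Phi (t ++ [true])).

Definition computably_random_wrt (Phi : cantor -> cantor) (Y : cantor) : Prop :=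
  forall b, Phi_martingale Phi b -> computable_real_fun b -> ~ succeeds b Y.

(* injectivity (extensional, since elements of 2^w are functions) *)
Definition injective_functional (Phi : cantor -> cantor) : Prop :=
  forall X Y : cantor, (forall n, Phi X n = Phi Y n) -> forall n, X n = Y n.

(* Main.v *)
Require Import Defs.
From Stdlib Require Import Reals List Lra Lia ZArith Arith Bool ClassicalEpsilon.
Import ListNotations.

(** Let [b] be a computable [Phi]-martingale.  A savings strategy [sav] turns it into
    another one that tends to infinity along every sequence on which [b] is unbounded:
    it stakes the fraction [/ 2 ^ e] of [b], where the exponent [e] is nondecreasing,
    [b <= 2 ^ e], and [e] grows only when [b] is at least [2 ^ e / 4].

    By compactness [Phi] has a computable modulus of continuity, and by injectivity
    [Phi X | n] determines [X | k] for some [n] found computably from [k].  So for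
    large [n] the average of [sav (Phi X | n)] over the cylinder of [s] does not depend
    on [n]: each cylinder of length [n] pulls back inside or outside that of [s], and
    [sav] is fair on it.  These averages form a computable martingale, which tends to
    infinity along [X] because [sav] never falls below the amount already banked. *)

(** Pulling back [b] itself would not do. A large value of [b] at a prefix [t] of [Phi X] says
    nothing about its later averages over a small cylinder around [X] inside the preimage of [t],
    where [b] may lose everything; money in the bank bounds all these averages from below.

    The staked fraction is a power of two, so that from dyadic approximations of [b] everything else
    is exactly dyadic. For fixed [e] the strategy is linear in [b] with total weight at most one, so
    the approximation error does not grow.

    Both moduli exist by a classical compactness argument; unbounded search for a condition on
    finitely many strings then makes them computable. *)

Section Programs.
Local Open Scope nat_scope.

(** * Programs for arithmetic and pairing *)

Lemma eval_comp1 f g a y z : eval g a y -> eval f [y] z -> eval (PComp f [g]) a z.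
Proof. intros Hg Hf; econstructor; [repeat econstructor; eassumption | exact Hf]. Qed.

Lemma eval_comp2 f g h a x y z :
  eval g a x -> eval h a y -> eval f [x; y] z -> eval (PComp f [g; h]) a z.
Proof.
  intros Hg Hh Hf; econstructor; [| exact Hf].
  constructor; [exact Hg | constructor; [exact Hh | constructor]].
Qed.

Lemma eval_proj i a y : nth i a 0 = y -> eval (PProj i) a y.
Proof. intros <-; constructor. Qed.

Lemma eval_prim f g a base step n :
  eval f a base -> (forall k r, eval g (k :: r :: a) (step k r)) ->
  eval (PPrim f g) (n :: a) (nat_rect (fun _ => nat) base step n).
Proof.
  intros Hf Hg; induction n as [|n IH]; simpl.
  - now constructor.
  - econstructor; [exact IH | apply Hg].
Qed.

Fixpoint p_const (c : nat) : prf :=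
  match c with O => PZero | S c => PComp PSucc [p_const c] end.

Lemma eval_const c a : eval (p_const c) a c.
Proof.
  induction c as [|c IH]; [constructor|].
  eapply eval_comp1; [exact IH | exact (ev_succ [c])].
Qed.

Definition computes2 (F : nat -> nat -> nat) : Prop :=
  exists p, forall x y, eval p [x; y] (F x y).

Lemma computes2_rec F base step :
  (exists p, forall y, eval p [y] (base y)) ->
  (exists p, forall k r y, eval p [k; r; y] (step k r y)) ->
  (forall x y, nat_rect (fun _ => nat) (base y) (fun k r => step k r y) x = F x y) ->
  computes2 F.
Proof.
  intros [p Hp] [q Hq] HF; exists (PPrim p q); intros x y; rewrite <- HF.
  apply (eval_prim p q [y] (base y) (fun k r => step k r y)); auto.
Qed.

Lemma computes2_flip F : computes2 F -> computes2 (fun x y => F y x).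
Proof.
  intros [p Hp]; exists (PComp p [PProj 1; PProj 0]); intros x y.
  eapply eval_comp2; [now apply eval_proj | now apply eval_proj | apply Hp].
Qed.

Lemma computes2_add : computes2 Nat.add.
Proof.
  apply (computes2_rec _ (fun y => y) (fun _ r _ => S r)).
  - exists (PProj 0); intro; now apply eval_proj.
  - exists (PComp PSucc [PProj 1]); intros k r y.
    eapply eval_comp1; [now apply eval_proj | exact (ev_succ [r])].
  - intros x y; induction x; simpl; congruence.
Qed.

Lemma computes2_sub : computes2 Nat.sub.
Proof.
  assert (Hpred : forall a x, eval (PPrim PZero (PProj 0)) (x :: a) (pred x)).
  { intros a [|x]; [now repeat constructor|].
    apply ev_primS with (r := pred x); [|now apply eval_proj].
    induction x as [|x IH]; [now repeat constructor|].
    econstructor; [exact IH | now apply eval_proj]. }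
  (* Primitive recursion runs on the first argument, but [pred] is iterated as often as the
     subtrahend says; hence the swap. *)
  apply (computes2_flip (fun y x => x - y)).
  apply (computes2_rec _ (fun y => y) (fun _ r _ => pred r)).
  - exists (PProj 0); intro; now apply eval_proj.
  - exists (PComp (PPrim PZero (PProj 0)) [PProj 1]); intros k r y.
    eapply eval_comp1; [now apply eval_proj | apply Hpred].
  - intros x y; induction x; simpl; lia.
Qed.

Lemma computes2_mul : computes2 Nat.mul.
Proof.
  destruct computes2_add as [p Hp].
  apply (computes2_rec _ (fun _ => 0) (fun _ r y => r + y)).
  - exists PZero; constructor.
  - exists (PComp p [PProj 1; PProj 2]); intros k r y.
    eapply eval_comp2; [now apply eval_proj | now apply eval_proj | apply Hp].
  - intros x y; induction x; simpl; lia.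
Qed.

Fixpoint tri (n : nat) : nat :=
  match n with O => 0 | S n => tri n + S n end.

Lemma tri_le m n : m <= n -> tri m <= tri n.
Proof. induction 1; simpl; lia. Qed.

Lemma eval_tri : exists p, forall n a, eval p (n :: a) (tri n).
Proof.
  destruct computes2_add as [p Hp].
  exists (PPrim PZero (PComp p [PProj 1; PComp PSucc [PProj 0]])); intros n a.
  replace (tri n) with (nat_rect (fun _ => nat) 0 (fun k r => r + S k) n)
    by (induction n; simpl; congruence).
  apply (eval_prim _ _ a 0 (fun k r => r + S k)); [constructor | intros k r].
  eapply eval_comp2; [now apply eval_proj | | apply Hp].
  eapply eval_comp1; [now apply eval_proj | exact (ev_succ [k])].
Qed.

(** Cantor pairing: [tri (x + y)] is where the diagonal of [(x, y)] starts, and [y] is the position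
    on it. *)
Definition npair (x y : nat) : nat := y + tri (x + y).

Lemma computes2_npair : computes2 npair.
Proof.
  destruct computes2_add as [p Hp], eval_tri as [t Ht].
  exists (PComp p [PProj 1; PComp t [p]]); intros x y.
  eapply eval_comp2; [now apply eval_proj | | apply Hp].
  eapply eval_comp1; [apply Hp | apply Ht].
Qed.

(* The least [s] with [npair x y < tri (S s)] is [x + y]. *)
Lemma eval_npair_sum :
  exists p, forall x y, eval p [npair x y] (x + y).
Proof.
  destruct computes2_sub as [p Hp], eval_tri as [t Ht].
  exists (PMu (PComp p [PComp PSucc [PProj 1]; PComp t [PComp PSucc [PProj 0]]])).
  intros x y.
  assert (H : forall s, eval (PComp p [PComp PSucc [PProj 1]; PComp t [PComp PSucc [PProj 0]]])
                [s; npair x y] (S (npair x y) - tri (S s))).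
  { intro s; eapply eval_comp2; [| | apply Hp].
    - eapply eval_comp1; [now apply eval_proj | exact (ev_succ [npair x y])].
    - eapply eval_comp1; [| apply Ht].
      eapply eval_comp1; [now apply eval_proj | exact (ev_succ [s])]. }
  constructor.
  - assert (E : S (npair x y) - tri (S (x + y)) = 0) 
      by (unfold npair; change (tri (S (x + y))) with (tri (x + y) + S (x + y)); lia).
    pose proof (H (x + y)) as Hxy; rewrite E in Hxy; exact Hxy.
  - intros s Hs; eexists; split; [| apply H].
    assert (tri (S s) <= tri (x + y)) by (apply tri_le; lia).
    unfold npair; lia.
Qed.

Lemma eval_npair_snd : exists p, forall x y, eval p [npair x y] y.
Proof.
  destruct computes2_sub as [p Hp], eval_tri as [t Ht], eval_npair_sum as [s Hs].
  exists (PComp p [PProj 0; PComp t [s]]); intros x y.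
  replace y with (npair x y - tri (x + y)) at 2 by (unfold npair; lia).
  eapply eval_comp2; [now apply eval_proj | | apply Hp].
  eapply eval_comp1; [apply Hs | apply Ht].
Qed.

Lemma eval_npair_fst : exists p, forall x y, eval p [npair x y] x.
Proof.
  destruct computes2_sub as [p Hp], eval_npair_snd as [t Ht], eval_npair_sum as [s Hs].
  exists (PComp p [s; t]); intros x y.
  replace x with ((x + y) - y) at 2 by lia.
  eapply eval_comp2; [apply Hs | apply Ht | apply Hp].
Qed.

End Programs.

(** * Computable maps between encoded types *)

Class Enc (A : Type) := enc : A -> nat.

#[local] Instance Enc_nat : Enc nat := fun n => n.
#[local] Instance Enc_bool : Enc bool := fun b => if b then 1%nat else 0%nat.
#[local] Instance Enc_bstring : Enc bstring := code_bs.
#[local] Instance Enc_Z : Enc Z := code_Z.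
#[local] Instance Enc_prod A B `{Enc A} `{Enc B} : Enc (A * B) :=
  fun p => npair (enc (fst p)) (enc (snd p)).

Definition Comp {A B} `{Enc A} `{Enc B} (f : A -> B) : Prop :=
  exists p, forall a, eval p [enc a] (enc (f a)).

Section Closure.
Local Open Scope nat_scope.
Context {G : Type} {EG : Enc G}.

Lemma Comp_id : Comp (fun x : G => x).
Proof. exists (PProj 0); intro; now apply eval_proj. Qed.

Lemma Comp_const {A} `{Enc A} (c : A) : Comp (fun _ : G => c).
Proof. exists (p_const (enc c)); intro; apply eval_const. Qed.

Lemma Comp_comp {A B} `{Enc A} `{Enc B} (f : A -> B) (x : G -> A) :
  Comp f -> Comp x -> Comp (fun g => f (x g)).
Proof.
  intros [p Hp] [q Hq]; exists (PComp p [q]); intro g.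
  eapply eval_comp1; [apply Hq | apply Hp].
Qed.

Lemma Comp_pair {A B} `{Enc A} `{Enc B} (x : G -> A) (y : G -> B) :
  Comp x -> Comp y -> Comp (fun g => (x g, y g)).
Proof.
  intros [p Hp] [q Hq]; destruct computes2_npair as [r Hr].
  exists (PComp r [p; q]); intro g.
  eapply eval_comp2; [apply Hp | apply Hq | apply Hr].
Qed.

Lemma Comp_fst {A B} `{Enc A} `{Enc B} (x : G -> A * B) :
  Comp x -> Comp (fun g => fst (x g)).
Proof.
  intros [p Hp]; destruct eval_npair_fst as [r Hr].
  exists (PComp r [p]); intro g; eapply eval_comp1; [apply Hp | apply Hr].
Qed.

Lemma Comp_snd {A B} `{Enc A} `{Enc B} (x : G -> A * B) :
  Comp x -> Comp (fun g => snd (x g)).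
Proof.
  intros [p Hp]; destruct eval_npair_snd as [r Hr].
  exists (PComp r [p]); intro g; eapply eval_comp1; [apply Hp | apply Hr].
Qed.

Lemma Comp_comp2 {A B C} `{Enc A} `{Enc B} `{Enc C} (f : A -> B -> C) (x : G -> A) (y : G -> B) :
  Comp (fun p => f (fst p) (snd p)) -> Comp x -> Comp y -> Comp (fun g => f (x g) (y g)).
Proof.
  intros Hf Hx Hy.
  exact (Comp_comp (fun p => f (fst p) (snd p)) (fun g => (x g, y g)) Hf
           (Comp_pair _ _ Hx Hy)).
Qed.

Lemma Comp_computes2 F (x y : G -> nat) :
  computes2 F -> Comp x -> Comp y -> Comp (fun g => F (x g) (y g)).
Proof.
  intros [r Hr] [p Hp] [q Hq]; exists (PComp r [p; q]); intro g.
  eapply eval_comp2; [apply Hp | apply Hq | apply Hr].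
Qed.

Definition Comp_add x y := Comp_computes2 Nat.add x y computes2_add.
Definition Comp_sub x y := Comp_computes2 Nat.sub x y computes2_sub.
Definition Comp_mul x y := Comp_computes2 Nat.mul x y computes2_mul.

Lemma Comp_ext {A} `{Enc A} (f h : G -> A) :
  (forall g, f g = h g) -> Comp f -> Comp h.
Proof. intros E [p Hp]; exists p; intro g; rewrite <- E; apply Hp. Qed.

(** Computability sees only codes, so values may change type as long as their codes agree. This
    reduces Booleans, integers and strings to arithmetic. *)
Lemma Comp_enc_ext {A B} `{Enc A} `{Enc B} (f : G -> A) (h : G -> B) :
  (forall g, enc (f g) = enc (h g)) -> Comp f -> Comp h.
Proof. intros E [p Hp]; exists p; intro g; rewrite <- E; apply Hp. Qed.

Lemma Comp_enc {A} `{Enc A} (x : G -> A) : Comp x -> Comp (fun g => enc (x g) : nat).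
Proof. intro Hx; exact Hx. Qed.

Lemma Comp_S x : Comp x -> Comp (fun g : G => S (x g)).
Proof.
  intro Hx; apply (Comp_ext (fun g => x g + 1)); [intro; lia|].
  apply Comp_add; [exact Hx | apply Comp_const].
Qed.

Lemma Comp_if {A} `{Enc A} (c : G -> bool) (x y : G -> A) :
  Comp c -> Comp x -> Comp y -> Comp (fun g => if c g then x g else y g).
Proof.
  intros Hc Hx Hy.
  (* Both branches are total, so the choice can be made by arithmetic on the codes. *)
  apply (Comp_enc_ext
    (fun g => (enc (c g) : nat) * (enc (x g) : nat) + (1 - enc (c g)) * (enc (y g) : nat))).
  - intro g; destruct (c g); cbn [enc Enc_nat Enc_bool];
      change (@enc nat Enc_nat) with (fun n : nat => n); cbn beta; simpl; lia.
  - apply Comp_add; apply Comp_mul; try apply Comp_sub; try apply Comp_const.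
    all: now apply Comp_enc.
Qed.

Lemma Comp_leb x y : Comp x -> Comp y -> Comp (fun g : G => Nat.leb (x g) (y g)).
Proof.
  intros Hx Hy; apply (Comp_enc_ext (fun g => 1 - (x g - y g))).
  - intro g; unfold enc, Enc_nat, Enc_bool; destruct (Nat.leb_spec (x g) (y g)); lia.
  - repeat (apply Comp_sub || apply Comp_const || assumption).
Qed.

Lemma Comp_andb x y : Comp x -> Comp y -> Comp (fun g : G => andb (x g) (y g)).
Proof. intros Hx Hy; apply (Comp_if _ _ _ Hx Hy), Comp_const. Qed.

Lemma Comp_orb x y : Comp x -> Comp y -> Comp (fun g : G => orb (x g) (y g)).
Proof. intros Hx Hy; apply (Comp_if _ _ _ Hx); [apply Comp_const | exact Hy]. Qed.

Lemma Comp_negb x : Comp x -> Comp (fun g : G => negb (x g)).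
Proof. intros Hx; apply (Comp_if _ _ _ Hx); apply Comp_const. Qed.

Lemma Comp_eqb x y : Comp x -> Comp y -> Comp (fun g : G => Nat.eqb (x g) (y g)).
Proof.
  intros Hx Hy.
  apply (Comp_ext (fun g => andb (Nat.leb (x g) (y g)) (Nat.leb (y g) (x g)))).
  - intro g; destruct (Nat.eqb_spec (x g) (y g)), (Nat.leb_spec (x g) (y g)),
      (Nat.leb_spec (y g) (x g)); simpl; lia.
  - apply Comp_andb; apply Comp_leb; assumption.
Qed.

Lemma Comp_rec {A} `{Enc A} (n : G -> nat) (base : G -> A) (step : G -> nat -> A -> A) :
  Comp n -> Comp base ->
  Comp (fun p : G * (nat * A) => step (fst p) (fst (snd p)) (snd (snd p))) ->
  Comp (fun g => nat_rect (fun _ => A) (base g) (step g) (n g)).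
Proof.
  intros [p Hp] [q Hq] [r Hr]; destruct computes2_npair as [t Ht].
  (* [PPrim] supplies counter, accumulator and parameter in this order; the pairings rearrange them
     into the code of [(g, (k, r))]. *)
  exists (PComp (PPrim q (PComp r [PComp t [PProj 2; PComp t [PProj 0; PProj 1]]]))
            [p; PProj 0]); intro g.
  eapply eval_comp2; [apply Hp | now apply eval_proj |].
  unfold enc at 1, Enc_nat.
  induction (n g) as [|k IH]; simpl.
  - constructor; apply Hq.
  - econstructor; [exact IH|].
    eapply eval_comp1; [| apply (Hr (g, (k, nat_rect (fun _ => A) (base g) (step g) k)))].
    eapply eval_comp2; [now apply eval_proj | | apply Ht].
    eapply eval_comp2; [now apply eval_proj | now apply eval_proj | apply Ht].
Qed.

End Closure.

Section Minimization.
Local Open Scope nat_scope.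
Context {G : Type} {EG : Enc G}.

(** Turns a classical existence proof for a decidable property into a computable function.
    Minimality serves to identify that function, or to bound it. *)
Lemma Comp_min (P : G -> nat -> bool) :
  Comp (fun p : G * nat => P (fst p) (snd p)) ->
  (forall g, exists n, P g n = true) ->
  exists f : G -> nat, Comp f /\ (forall g, P g (f g) = true) /\
    forall g n, P g n = true -> f g <= n.
Proof.
  intros HP Hex.
  assert (Hmin : forall g, exists n, P g n = true /\ forall k, P g k = true -> n <= k).
  { intro g; destruct (Hex g) as [n0 Hn0].
    revert Hn0; induction (lt_wf n0) as [n _ IH]; intro Hn.
    destruct (excluded_middle_informative (exists k, k < n /\ P g k = true))
      as [[k [Hk Pk]] | Hno].
    - exact (IH k Hk Pk).
    - exists n; split; [exact Hn|]; intros k Pk.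
      destruct (le_lt_dec n k); [assumption | exfalso; eauto]. }
  pose (f g := proj1_sig (constructive_indefinite_description _ (Hmin g))).
  assert (Hf : forall g, P g (f g) = true /\ forall k, P g k = true -> f g <= k)
    by (intro g; exact (proj2_sig (constructive_indefinite_description _ (Hmin g)))).
  exists f; split; [| split; [intro; apply Hf | intros; now apply Hf]].
  destruct (Comp_negb _ HP) as [p Hp], computes2_npair as [t Ht].
  (* [PMu] looks for a zero, and [false] has code 0; hence the negation of [P]. *)
  exists (PMu (PComp p [PComp t [PProj 1; PProj 0]])); intro g.
  assert (E : forall n, eval (PComp p [PComp t [PProj 1; PProj 0]]) [n; enc g]
                          (enc (negb (P g n)))).
  { intro n; eapply eval_comp1; [| apply (Hp (g, n))].
    eapply eval_comp2; [now apply eval_proj | now apply eval_proj | apply Ht]. }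
  constructor.
  - specialize (E (f g)); rewrite (proj1 (Hf g)) in E; exact E.
  - intros m Hm; eexists; split; [| apply E].
    destruct (P g m) eqn:Pm; [| discriminate].
    apply Hf in Pm; unfold enc, Enc_nat in Hm; lia.
Qed.

End Minimization.

Ltac comp_base :=
  match goal with
  | H : Comp ?f |- Comp ?f => exact H
  | |- Comp (fun g => g) => apply Comp_id
  | |- Comp fst => apply (Comp_fst (fun x => x))
  | |- Comp snd => apply (Comp_snd (fun x => x))
  | |- Comp (fun _ => ?c) => apply Comp_const
  | |- Comp (fun g => (@?x g, @?y g)) => apply (Comp_pair x y)
  | |- Comp (fun g => fst (@?x g)) => apply (Comp_fst x)
  | |- Comp (fun g => snd (@?x g)) => apply (Comp_snd x)
  | |- Comp (fun g => S (@?x g)) => apply (Comp_S x)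
  | |- Comp (fun g => (@?x g + @?y g)%nat) => apply (Comp_add x y)
  | |- Comp (fun g => (@?x g - @?y g)%nat) => apply (Comp_sub x y)
  | |- Comp (fun g => (@?x g * @?y g)%nat) => apply (Comp_mul x y)
  | |- Comp (fun g => Nat.leb (@?x g) (@?y g)) => apply (Comp_leb x y)
  | |- Comp (fun g => Nat.eqb (@?x g) (@?y g)) => apply (Comp_eqb x y)
  | |- Comp (fun g => andb (@?x g) (@?y g)) => apply (Comp_andb x y)
  | |- Comp (fun g => orb (@?x g) (@?y g)) => apply (Comp_orb x y)
  | |- Comp (fun g => negb (@?x g)) => apply (Comp_negb x)
  | |- Comp (fun g => if @?c g then @?x g else @?y g) => apply (Comp_if c x y)
  | H : Comp ?f |- Comp (fun g => ?f (@?x g)) => apply (Comp_comp f x H)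
  | H : Comp (fun p => ?f (fst p) (snd p)) |- Comp (fun g => ?f (@?x g) (@?y g)) =>
      apply (Comp_comp2 f x y H)
  end; cbv beta.

Ltac comp_step := comp_base.

Ltac comp := repeat comp_step.

Section MoreClosure.
Local Open Scope nat_scope.
Context {G : Type} {EG : Enc G}.

Lemma Comp_pow2 (n : G -> nat) : Comp n -> Comp (fun g => 2 ^ n g).
Proof.
  intro Hn; apply (Comp_ext (fun g => nat_rect (fun _ => nat) 1 (fun _ r => 2 * r) (n g))).
  - intro g; induction (n g); simpl in *; congruence.
  - apply (Comp_rec n (fun _ => 1) (fun _ _ r => 2 * r)); comp.
Qed.

Definition ball (n : nat) (P : nat -> bool) : bool :=
  nat_rect (fun _ => bool) true (fun i r => andb (P i) r) n.

Lemma ball_spec n P : ball n P = true <-> forall i, i < n -> P i = true.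
Proof.
  induction n as [|n IH]; simpl.
  - split; [intros _ i Hi; lia | reflexivity].
  - rewrite andb_true_iff, IH; split.
    + intros [Hn H] i Hi; destruct (Nat.eq_dec i n) as [->|]; [exact Hn | apply H; lia].
    + intro H; split; [apply H; lia | intros; apply H; lia].
Qed.

Lemma Comp_ball (n : G -> nat) (P : G -> nat -> bool) :
  Comp n -> Comp (fun p : G * nat => P (fst p) (snd p)) ->
  Comp (fun g => ball (n g) (P g)).
Proof.
  intros Hn HP; apply (Comp_rec n (fun _ => true) (fun g i r => andb (P g i) r)); comp.
Qed.

End MoreClosure.

(** * Binary strings *)

Section Strings.
Local Open Scope nat_scope.

Lemma pow2_pos n : 0 < 2 ^ n.
Proof. induction n; simpl; lia. Qed.

(** The code is a numeral in base two with digits 1 and 2, so its size determines the length of the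
    string. *)
Lemma code_bs_bounds s : 2 ^ length s <= code_bs s + 1 < 2 * 2 ^ length s.
Proof. induction s as [|[] s IH]; simpl; lia. Qed.

Lemma code_bs_inj s t : code_bs s = code_bs t -> s = t.
Proof.
  revert t; induction s as [|a s IH]; intros [|b t]; simpl; try reflexivity.
  - destruct b; lia.
  - destruct a; lia.
  - intro H; assert (a = b) as <- by (destruct a, b; lia || reflexivity).
    f_equal; apply IH; destruct a; lia.
Qed.

Lemma code_bs_surj c : exists s, code_bs s = c.
Proof.
  induction (lt_wf c) as [c _ IH]; destruct (Nat.Even_or_Odd c) as [[k Hk]|[k Hk]].
  - destruct k as [|k]; [now exists []; simpl|].
    destruct (IH k) as [s Hs]; [lia|]; exists (true :: s); simpl; lia.
  - destruct (IH k) as [s Hs]; [lia|]; exists (false :: s); simpl; lia.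
Qed.

Definition dec (c : nat) : bstring :=
  proj1_sig (constructive_indefinite_description _ (code_bs_surj c)).

Lemma code_bs_dec c : code_bs (dec c) = c.
Proof. exact (proj2_sig (constructive_indefinite_description _ (code_bs_surj c))). Qed.

Lemma dec_code_bs s : dec (code_bs s) = s.
Proof. apply code_bs_inj, code_bs_dec. Qed.

(** The first letter is the least significant digit, so dropping [j] letters is a shift by [j]
    places. *)
Lemma code_bs_split j s : code_bs s = code_bs (firstn j s) + 2 ^ j * code_bs (skipn j s).
Proof.
  revert s; induction j as [|j IH]; intro s; simpl; [lia|].
  destruct s as [|a s]; simpl; [lia | pose proof (IH s); destruct a; lia].
Qed.

Definition bs_eqb (s t : bstring) : bool := Nat.eqb (code_bs s) (code_bs t).

Lemma bs_eqb_spec s t : reflect (s = t) (bs_eqb s t).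
Proof.
  unfold bs_eqb; destruct (Nat.eqb_spec (code_bs s) (code_bs t)); constructor.
  - now apply code_bs_inj.
  - congruence.
Qed.

(* The strings of length [n] are exactly those with code in [2^n - 1, 2^(n+1) - 1). *)
Definition nth_string (n i : nat) : bstring := dec (2 ^ n - 1 + i).

Lemma length_nth_string n i : i < 2 ^ n -> length (nth_string n i) = n.
Proof.
  intro Hi; pose proof (code_bs_bounds (nth_string n i)) as H.
  assert (E : code_bs (nth_string n i) = 2 ^ n - 1 + i) by apply code_bs_dec.
  rewrite E in H; set (l := length (nth_string n i)) in *.
  destruct (lt_eq_lt_dec l n) as [[Hl|]|Hl]; [| assumption |].
  - pose proof (Nat.pow_le_mono_r 2 (S l) n ltac:(lia) Hl); simpl in *; lia.
  - pose proof (Nat.pow_le_mono_r 2 (S n) l ltac:(lia) Hl); simpl in *; lia.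
Qed.

Lemma nth_string_surj s : exists i, i < 2 ^ length s /\ nth_string (length s) i = s.
Proof.
  pose proof (code_bs_bounds s).
  exists (code_bs s - (2 ^ length s - 1)); split; [lia|].
  unfold nth_string; rewrite <- (dec_code_bs s) at 4; f_equal; lia.
Qed.

Definition sball (n : nat) (P : bstring -> bool) : bool :=
  ball (2 ^ n) (fun i => P (nth_string n i)).

Lemma sball_spec n P : sball n P = true <-> forall s, length s = n -> P s = true.
Proof.
  unfold sball; rewrite ball_spec; split.
  - intros H s <-; destruct (nth_string_surj s) as [i [Hi E]].
    rewrite <- E; apply H, Hi.
  - intros H i Hi; apply H, length_nth_string, Hi.
Qed.

End Strings.

(** * Computability of string operations *)

Lemma Comp_code {G} `{Enc G} (x : G -> bstring) : Comp x -> Comp (fun g => code_bs (x g)).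
Proof. intro Hx; exact Hx. Qed.

(** [dec] is defined by choice, yet the code of [dec c] is [c] itself, so no computation takes
    place. *)
Lemma Comp_dec {G} `{Enc G} (x : G -> nat) : Comp x -> Comp (fun g => dec (x g)).
Proof.
  intro Hx; apply (Comp_enc_ext x); [| exact Hx].
  intro g; symmetry; exact (code_bs_dec (x g)).
Qed.

Section StringClosure.
Local Open Scope nat_scope.
Context {G : Type} {EG : Enc G}.

Lemma Comp_length (x : G -> bstring) : Comp x -> Comp (fun g => length (x g)).
Proof.
  intro Hx.
  destruct (Comp_min (fun g n => Nat.leb (code_bs (x g) + 2) (2 * 2 ^ n))) as [f [Hf [H1 H2]]].
  - apply Comp_leb; comp; [apply Comp_code; comp | apply Comp_pow2; comp].
  - intro g; exists (length (x g)); apply Nat.leb_le.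
    pose proof (code_bs_bounds (x g)); lia.
  - apply (Comp_ext f); [| exact Hf]; intro g.
    pose proof (code_bs_bounds (x g)) as B.
    specialize (H1 g); apply Nat.leb_le in H1.
    apply Nat.le_antisymm; [apply H2, Nat.leb_le; lia |].
    apply Nat.nlt_ge; intro Hlt.
    pose proof (Nat.pow_le_mono_r 2 (S (f g)) _ ltac:(lia) Hlt); simpl in *; lia.
Qed.

(* [code_bs (skipn j s)] is the least [t] with [code_bs s + 2 <= 2^(j+1) + 2^j * t]. *)
Lemma Comp_firstn (j : G -> nat) (x : G -> bstring) :
  Comp j -> Comp x -> Comp (fun g => firstn (j g) (x g)).
Proof.
  intros Hj Hx.
  assert (B : forall g, code_bs (x g) + 2 <= 2 * 2 ^ j g + 2 ^ j g * code_bs (skipn (j g) (x g))).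
  { intro g; rewrite (code_bs_split (j g) (x g)) at 1.
    pose proof (code_bs_bounds (firstn (j g) (x g))) as B.
    pose proof (Nat.pow_le_mono_r 2 _ _ ltac:(lia) (firstn_le_length (j g) (x g))); lia. }
  destruct (Comp_min (fun g t => Nat.leb (code_bs (x g) + 2) (2 * 2 ^ j g + 2 ^ j g * t)))
    as [f [Hf [H1 H2]]].
  - apply Comp_leb; comp; [apply Comp_code; comp | apply Comp_pow2; comp..].
  - intro g; eexists; apply Nat.leb_le, B.
  - assert (E : forall g, f g = code_bs (skipn (j g) (x g))).
    { intro g; specialize (H1 g); apply Nat.leb_le in H1.
      apply Nat.le_antisymm; [apply H2, Nat.leb_le, B|].
      destruct (le_lt_dec (length (x g)) (j g)) as [Hl|Hl].
      - rewrite skipn_all2 by exact Hl; simpl; lia.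
      (* Here the prefix has exactly [j] letters, so its code is at least [2^j - 1], too large for a
         smaller [t] to pass the test. *)
      - apply Nat.nlt_ge; intro Hlt.
        rewrite (code_bs_split (j g) (x g)) in H1.
        pose proof (code_bs_bounds (firstn (j g) (x g))) as C.
        rewrite firstn_length_le in C by lia.
        pose proof (Nat.mul_le_mono_l (S (f g)) _ (2 ^ j g) Hlt); lia. }
    apply (Comp_enc_ext (fun g => code_bs (x g) - 2 ^ j g * f g)).
    + intro g; rewrite E, (code_bs_split (j g) (x g)) at 1.
      unfold enc, Enc_nat, Enc_bstring; lia.
    + comp; [apply Comp_code; comp | apply Comp_pow2; comp].
Qed.

Lemma Comp_bs_eqb (x y : G -> bstring) :
  Comp x -> Comp y -> Comp (fun g => bs_eqb (x g) (y g)).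
Proof. intros Hx Hy; apply Comp_eqb; apply Comp_code; assumption. Qed.

Lemma Comp_nth_string (n i : G -> nat) :
  Comp n -> Comp i -> Comp (fun g => nth_string (n g) (i g)).
Proof. intros Hn Hi; apply Comp_dec; comp; apply Comp_pow2, Hn. Qed.

End StringClosure.

Ltac comp_step ::=
  first
  [ comp_base
  | match goal with
    | |- Comp (fun g => (2 ^ @?x g)%nat) => apply (Comp_pow2 x)
    | |- Comp (fun g => code_bs (@?x g)) => apply (Comp_code x)
    | |- Comp (fun g => length (@?x g)) => apply (Comp_length x)
    | |- Comp (fun g => firstn (@?n g) (@?x g)) => apply (Comp_firstn n x)
    | |- Comp (fun g => bs_eqb (@?x g) (@?y g)) => apply (Comp_bs_eqb x y)
    | |- Comp (fun g => nth_string (@?x g) (@?y g)) => apply (Comp_nth_string x y)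
    | |- Comp (fun g => ball (@?n g) (@?P g)) => apply (Comp_ball n P)
    end; cbv beta ].

Section SBall.
Context {G : Type} {EG : Enc G}.

Lemma Comp_sball (n : G -> nat) (P : G -> bstring -> bool) :
  Comp n -> Comp (fun p : G * bstring => P (fst p) (snd p)) ->
  Comp (fun g => sball (n g) (P g)).
Proof.
  intros Hn HP; apply (Comp_ball (fun g => 2 ^ n g)%nat (fun g i => P g (nth_string (n g) i)));
    comp.
Qed.

End SBall.

(** * Finite sums *)

Fixpoint rsum (n : nat) (f : nat -> R) : R :=
  match n with O => 0 | S n => rsum n f + f n end.

Lemma rsum_ext n f h : (forall i, (i < n)%nat -> f i = h i) -> rsum n f = rsum n h.
Proof.
  induction n as [|n IH]; simpl; intro H; [reflexivity|].
  rewrite IH by (intros; apply H; lia); now rewrite (H n) by lia.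
Qed.

Lemma rsum_double n f : rsum (2 * n) f = rsum n (fun i => f (2 * i)%nat + f (S (2 * i))).
Proof.
  induction n as [|n IH]; [reflexivity|].
  replace (2 * S n)%nat with (S (S (2 * n))) by lia; cbn [rsum]; rewrite IH; ring.
Qed.

(** Splitting off the last letter is the form in which martingale equations and the refinement of
    cylinders by one bit appear. *)
Fixpoint ssum (n : nat) (f : bstring -> R) : R :=
  match n with
  | O => f []
  | S n => ssum n (fun s => f (s ++ [false]) + f (s ++ [true]))
  end.

Lemma ssum_ext n f h : (forall s, length s = n -> f s = h s) -> ssum n f = ssum n h.
Proof.
  revert f h; induction n as [|n IH]; simpl; intros f h H; [now apply H|].
  apply IH; intros s Hs; rewrite !H; [reflexivity | rewrite length_app; simpl; lia..].
Qed.

Lemma ssum_le n f h : (forall s, length s = n -> f s <= h s) -> ssum n f <= ssum n h.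
Proof.
  revert f h; induction n as [|n IH]; simpl; intros f h H; [now apply H|].
  apply IH; intros s Hs; apply Rplus_le_compat; apply H; rewrite length_app; simpl; lia.
Qed.

Lemma ssum_plus n f h : ssum n (fun s => f s + h s) = ssum n f + ssum n h.
Proof.
  revert f h; induction n as [|n IH]; simpl; intros f h; [reflexivity|].
  rewrite <- IH; apply ssum_ext; intros; ring.
Qed.

Lemma ssum_scal n c f : ssum n (fun s => c * f s) = c * ssum n f.
Proof.
  revert f; induction n as [|n IH]; simpl; intro f; [reflexivity|].
  rewrite <- IH; apply ssum_ext; intros; ring.
Qed.

Lemma ssum_const n c : ssum n (fun _ => c) = 2 ^ n * c.
Proof. induction n as [|n IH] in c |- *; simpl; [ring | rewrite IH; ring]. Qed.

Lemma ssum_nonneg n f : (forall s, length s = n -> 0 <= f s) -> 0 <= ssum n f.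
Proof.
  intro H; rewrite <- (Rmult_0_r (2 ^ n)), <- ssum_const; now apply ssum_le.
Qed.

Lemma ssum_exchange m n f :
  ssum m (fun s => ssum n (fun t => f s t)) = ssum n (fun t => ssum m (fun s => f s t)).
Proof.
  revert f; induction m as [|m IH]; simpl; intro f; [reflexivity|].
  rewrite <- IH; apply ssum_ext; intros; symmetry; apply ssum_plus.
Qed.

Lemma bs_eqb_snoc s t x y : bs_eqb (s ++ [x]) (t ++ [y]) = andb (bs_eqb s t) (Bool.eqb x y).
Proof.
  destruct (bs_eqb_spec (s ++ [x]) (t ++ [y])) as [E|E].
  - apply app_inj_tail in E as [-> ->]; destruct (bs_eqb_spec t t); [|congruence].
    now rewrite eqb_reflx.
  - destruct (bs_eqb_spec s t) as [->|]; [|reflexivity].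
    destruct (Bool.eqb_spec x y) as [->|]; [congruence | reflexivity].
Qed.

Lemma ssum_indicator n t f :
  length t = n -> ssum n (fun s => if bs_eqb s t then f s else 0) = f t.
Proof.
  revert t f; induction n as [|n IH]; intros t f Ht.
  - destruct t; [|discriminate]; simpl; now destruct (bs_eqb_spec [] []).
  - destruct (exists_last (l := t)) as [u [a ->]]; [now intros -> |].
    rewrite length_app in Ht; simpl in Ht |- *.
    rewrite <- (IH u (fun s => f (s ++ [a]))) by lia.
    apply ssum_ext; intros s _; rewrite !bs_eqb_snoc.
    destruct (bs_eqb_spec s u) as [->|], a; simpl; ring.
Qed.

Lemma ssum_cons n f :
  ssum (S n) f = ssum n (fun t => f (false :: t)) + ssum n (fun t => f (true :: t)).
Proof.
  revert f; induction n as [|n IH]; intro f; [simpl; ring|].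
  change (ssum (S (S n)) f) with (ssum (S n) (fun s => f (s ++ [false]) + f (s ++ [true]))).
  rewrite IH; reflexivity.
Qed.

(** Makes the sum over strings a loop over numbers, hence computable. *)
Lemma ssum_rsum n f : ssum n f = rsum (2 ^ n) (fun i => f (nth_string n i)).
Proof.
  revert f; induction n as [|n IH]; intro f.
  - simpl; rewrite Rplus_0_l; f_equal; symmetry; apply (dec_code_bs []).
  - rewrite ssum_cons, <- ssum_plus, IH.
    (* Putting [false] or [true] in front of string number [i] of length [n] gives strings number
       [2i] and [2i + 1] of length [S n]. *)
    change (2 ^ S n)%nat with (2 * 2 ^ n)%nat; rewrite rsum_double.
    pose proof (pow2_pos n).
    apply rsum_ext; intros i _; f_equal; f_equal; apply code_bs_inj;
      unfold nth_string; cbn [code_bs]; rewrite !code_bs_dec; simpl; lia.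
Qed.

Lemma fold_all_strings n f :
  fold_right Rplus 0 (map f (all_strings n)) = ssum n f.
Proof.
  revert f; induction n as [|n IH]; intro f; [simpl; apply Rplus_0_r|].
  simpl; rewrite <- IH; clear IH.
  induction (all_strings n) as [|s l IHl]; simpl; [reflexivity|].
  rewrite IHl; ring.
Qed.

(** * Uniformly dyadic functions and computable reals *)

(** Exact nonnegative dyadic values. Sums and products stay exact, so errors arise only when [b] is
    approximated and when the result is rounded in [computable_real_intro]. *)
Definition DC {G} `{Enc G} (f : G -> R) : Prop :=
  exists a n : G -> nat, Comp a /\ Comp n /\ forall g, f g = INR (a g) / 2 ^ n g.

Lemma pow2_gt0 n : 0 < 2 ^ n.
Proof. apply pow_lt; lra. Qed.

Lemma INR_pow2 n : INR (2 ^ n) = 2 ^ n.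
Proof. rewrite pow_INR; reflexivity. Qed.

Section DC.
Context {G : Type} {EG : Enc G}.

Lemma DC_nat (a : G -> nat) : Comp a -> DC (fun g => INR (a g)).
Proof.
  intro Ha; exists a, (fun _ => 0%nat); repeat split; comp; intro; simpl; field.
Qed.

Lemma DC_pow2 (n : G -> nat) : Comp n -> DC (fun g => 2 ^ n g).
Proof.
  intro Hn; exists (fun g => 2 ^ n g)%nat, (fun _ => 0%nat); repeat split; comp.
  intro; rewrite INR_pow2; simpl; field.
Qed.

Lemma DC_div_pow2 (f : G -> R) (n : G -> nat) : DC f -> Comp n -> DC (fun g => f g / 2 ^ n g).
Proof.
  intros (a & k & Ha & Hk & E) Hn; exists a, (fun g => k g + n g)%nat; repeat split; comp.
  intro g; rewrite E, pow_add; pose proof (pow2_gt0 (k g)); pose proof (pow2_gt0 (n g)).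
  field; lra.
Qed.

Lemma DC_mul (f h : G -> R) : DC f -> DC h -> DC (fun g => f g * h g).
Proof.
  intros (a & k & Ha & Hk & E) (b & n & Hb & Hn & F).
  exists (fun g => a g * b g)%nat, (fun g => k g + n g)%nat; repeat split; comp.
  intro g; rewrite E, F, pow_add, mult_INR.
  pose proof (pow2_gt0 (k g)); pose proof (pow2_gt0 (n g)); field; lra.
Qed.

Lemma DC_add (f h : G -> R) : DC f -> DC h -> DC (fun g => f g + h g).
Proof.
  intros (a & k & Ha & Hk & E) (b & n & Hb & Hn & F).
  exists (fun g => a g * 2 ^ n g + b g * 2 ^ k g)%nat, (fun g => k g + n g)%nat.
  repeat split; comp.
  intro g; rewrite E, F, pow_add, plus_INR, !mult_INR, !INR_pow2.
  pose proof (pow2_gt0 (k g)); pose proof (pow2_gt0 (n g)); field; lra.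
Qed.

Lemma DC_if (c : G -> bool) (f h : G -> R) :
  Comp c -> DC f -> DC h -> DC (fun g => if c g then f g else h g).
Proof.
  intros Hc (a & k & Ha & Hk & E) (b & n & Hb & Hn & F).
  exists (fun g => if c g then a g else b g), (fun g => if c g then k g else n g).
  repeat split; comp; intro g; destruct (c g); auto.
Qed.

Lemma DC_ext (f h : G -> R) : (forall g, f g = h g) -> DC f -> DC h.
Proof.
  intros E (a & n & Ha & Hn & F); exists a, n; repeat split; auto.
  intro; rewrite <- E; apply F.
Qed.

Lemma DC_comp {A} `{Enc A} (f : A -> R) (x : G -> A) : DC f -> Comp x -> DC (fun g => f (x g)).
Proof.
  intros (a & n & Ha & Hn & F) Hx; exists (fun g => a (x g)), (fun g => n (x g)).
  repeat split; comp; auto.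
Qed.

Lemma DC_rsum (n : G -> nat) (f : G -> nat -> R) :
  Comp n -> DC (fun p : G * nat => f (fst p) (snd p)) -> DC (fun g => rsum (n g) (f g)).
Proof.
  intros Hn (a & k & Ha & Hk & E).
  (* The state holds numerator and exponent of the partial sum; exponents are added to get a common
     denominator. *)
  pose (step (g : G) (i : nat) (r : nat * nat) :=
    ((fst r * 2 ^ k (g, i) + a (g, i) * 2 ^ snd r)%nat, (snd r + k (g, i))%nat)).
  pose (st g := nat_rect (fun _ => (nat * nat)%type) (0, 0)%nat (step g)).
  assert (Hst : Comp (fun g => st g (n g))).
  { apply (Comp_rec n (fun _ => (0, 0)%nat) step); unfold step; comp. }
  exists (fun g => fst (st g (n g))), (fun g => snd (st g (n g))); repeat split; comp.
  intro g; induction (n g) as [|m IH]; simpl; [field|].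
  pose proof (E (g, m)) as Em; cbn [fst snd] in Em; rewrite IH, Em; fold (st g).
  set (r := st g m); rewrite pow_add, plus_INR, !mult_INR, !INR_pow2.
  pose proof (pow2_gt0 (k (g, m))); pose proof (pow2_gt0 (snd r)); simpl; field; lra.
Qed.

End DC.

Lemma DC_ssum {G} `{Enc G} (n : G -> nat) (f : G -> bstring -> R) :
  Comp n -> DC (fun p : G * bstring => f (fst p) (snd p)) -> DC (fun g => ssum (n g) (f g)).
Proof.
  intros Hn Hf.
  apply (DC_ext (fun g => rsum (2 ^ n g) (fun i => f g (nth_string (n g) i))));
    [intro; symmetry; apply ssum_rsum|].
  apply (DC_rsum (fun g => 2 ^ n g)%nat (fun g i => f g (nth_string (n g) i))); [comp|].
  apply (DC_comp (fun p : G * bstring => f (fst p) (snd p))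
           (fun p : G * nat => (fst p, nth_string (n (fst p)) (snd p)))); [exact Hf | comp].
Qed.

Lemma Comp_to_nat {G} `{Enc G} (z : G -> Z) : Comp z -> Comp (fun g => Z.to_nat (z g)).
Proof.
  intro Hz; pose (c g := code_Z (z g)); assert (Hc : Comp c) by exact Hz.
  destruct (Comp_min (fun g h => Nat.leb (c g) (2 * h))) as [f [Hf [H1 H2]]].
  - comp.
  - intro g; exists (c g); apply Nat.leb_le; lia.
  (* [f] is half the code rounded up. Nonnegative integers have even codes; negative ones have odd
     codes and go to 0. *)
  - apply (Comp_ext (fun g => if Nat.eqb (c g) (2 * f g) then f g else 0%nat)); [|comp].
    intro g; specialize (H1 g); apply Nat.leb_le in H1.
    pose proof (H2 g (Z.to_nat (z g))) as H3; pose proof (H2 g (Z.to_nat (- z g))) as H4.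
    rewrite Nat.leb_le in H3, H4; unfold c in *.
    destruct (Nat.eqb_spec (code_Z (z g)) (2 * f g)), (z g); simpl in *; lia.
Qed.

Lemma Rabs_le_inv x y : Rabs x <= y -> - y <= x <= y.
Proof. intro H; pose proof (Rle_abs x); pose proof (Rle_abs (- x)); rewrite Rabs_Ropp in *; lra. Qed.

(** As [x] is nonnegative, raising a negative approximation to 0 moves it closer. The numerators
    become natural numbers, as [DC] demands. *)
Lemma clip_approx x q k : 0 <= x -> Rabs (x - IZR q / 2 ^ k) <= / 2 ^ k ->
  Rabs (x - INR (Z.to_nat q) / 2 ^ k) <= / 2 ^ k.
Proof.
  intros Hx Hq; destruct (Z_le_gt_dec 0 q) as [H|H].
  - now rewrite INR_IZR_INZ, Z2Nat.id.
  - replace (Z.to_nat q) with 0%nat by lia; simpl.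
    assert (IZR q <= 0) by (apply IZR_le; lia).
    pose proof (pow2_gt0 k) as P; apply Rinv_0_lt_compat in P.
    assert (IZR q / 2 ^ k <= 0) by (unfold Rdiv; nra).
    unfold Rdiv in *; rewrite Rmult_0_l, Rminus_0_r, Rabs_pos_eq by exact Hx.
    apply Rabs_le_inv in Hq; lra.
Qed.

Lemma computable_real_approx b : (forall s, 0 <= b s) -> computable_real_fun b ->
  exists beta : bstring -> nat -> nat,
    Comp (fun p => beta (fst p) (snd p)) /\
    forall s k, Rabs (b s - INR (beta s k) / 2 ^ k) <= / 2 ^ k.
Proof.
  intros Hb (q & p & Hp & Hq); exists (fun s k => Z.to_nat (q s k)); split.
  - apply Comp_to_nat.
    destruct eval_npair_fst as [l Hl], eval_npair_snd as [r Hr].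
    exists (PComp p [l; r]); intros [s k].
    eapply eval_comp2; [apply Hl | apply Hr | apply Hp].
  - intros; now apply clip_approx.
Qed.

(* A dyadic [a / 2^n] is rounded to precision [k] by the least [r] with
   [a / 2^n <= (r + 1/2) / 2^k]. *)
Lemma computable_real_intro m (f : bstring -> nat -> R) :
  DC (fun p : bstring * nat => f (fst p) (snd p)) ->
  (forall s k, Rabs (m s - f s k) <= / 2 ^ k) -> computable_real_fun m.
Proof.
  intros (a & n & Ha & Hn & E) Hf.
  (* The input is read at precision [S k], which leaves half of the error [/ 2^k] for rounding. *)
  destruct (Comp_min (fun (p : bstring * nat) r =>
    Nat.leb (a (fst p, S (snd p)) * 2 ^ S (snd p)) ((2 * r + 1) * 2 ^ n (fst p, S (snd p)))))
    as [r [Hr [H1 H2]]].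
  - comp.
  - intros [s k]; simpl; exists (a (s, S k) * 2 ^ S k)%nat; apply Nat.leb_le.
    pose proof (pow2_pos (n (s, S k))); simpl; nia.
  - assert (Hz : Comp (fun p => Z.of_nat (r p))).
    { apply (Comp_enc_ext (fun p => 2 * r p)%nat); [|comp].
      intro p; unfold enc, Enc_nat, Enc_Z; destruct (r p); [reflexivity|].
      simpl Z.of_nat; cbn [code_Z]; lia. }
    destruct Hz as [p Hp], computes2_npair as [t Ht].
    exists (fun s k => Z.of_nat (r (s, k))), (PComp p [t]); split; intros s k.
    + eapply eval_comp1; [apply Ht | apply (Hp (s, k))].
    + rewrite <- INR_IZR_INZ.
      specialize (H1 (s, k)); specialize (H2 (s, k)); specialize (Hf s (S k)).
      specialize (E (s, S k)); cbn [fst snd] in *; rewrite E in Hf.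
      apply Nat.leb_le in H1.
      (* By minimality [r - 1] fails the test, unless [r] is 0. *)
      assert (H3 : (r (s, k) = 0 \/
        (2 * r (s, k) - 1) * 2 ^ n (s, S k) < a (s, S k) * 2 ^ S k)%nat).
      { destruct (r (s, k)) as [|x] eqn:Hx; [now left | right].
        apply Nat.nle_gt; intro H; specialize (H2 x); rewrite Nat.leb_le in H2.
        replace (2 * S x - 1)%nat with (2 * x + 1)%nat in H by lia; specialize (H2 H); lia. }
      assert (I : forall k, / 2 ^ S k = / 2 ^ k / 2).
      { intro; simpl; pose proof (pow2_gt0 k0); field; lra. }
      assert (H : Rabs (INR (a (s, S k)) / 2 ^ n (s, S k) - INR (r (s, k)) / 2 ^ k) <= / 2 ^ S k).
      { set (A := a (s, S k)) in *; set (N := n (s, S k)) in *; set (x := r (s, k)) in *.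
        pose proof (pow2_gt0 k) as Pk; pose proof (pow2_gt0 N) as PN.
        assert (0 <= INR A / 2 ^ N).
        { pose proof (pos_INR A); apply Rmult_le_pos; [lra|]; left; now apply Rinv_0_lt_compat. }
        assert (U : INR A / 2 ^ N <= (2 * INR x + 1) * / 2 ^ S k).
        { apply le_INR in H1; rewrite !mult_INR, plus_INR, mult_INR, !INR_pow2 in H1.
          simpl INR in H1; apply Rmult_le_reg_r with (2 ^ N * 2 ^ S k).
          { apply Rmult_lt_0_compat; apply pow2_gt0. }
          pose proof (pow2_gt0 (S k)); field_simplify; [| lra | lra]. nra. }
        assert (L : (2 * INR x - 1) * / 2 ^ S k <= INR A / 2 ^ N).
        { destruct H3 as [->|H3].
          - simpl INR; apply Rle_trans with 0; [|assumption].
            pose proof (pow2_gt0 (S k)) as P; apply Rinv_0_lt_compat in P; nra.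
          - destruct x as [|y]; [simpl in H3 |]. 
            + simpl INR; apply Rle_trans with 0; [|assumption].
              pose proof (pow2_gt0 (S k)) as P; apply Rinv_0_lt_compat in P; nra.
            + apply lt_INR in H3; rewrite !mult_INR, minus_INR, mult_INR, !INR_pow2 in H3 by lia.
              simpl (INR 1) in H3; simpl (INR 2) in H3.
              apply Rmult_le_reg_r with (2 ^ N * 2 ^ S k).
              { apply Rmult_lt_0_compat; apply pow2_gt0. }
              pose proof (pow2_gt0 (S k)); field_simplify; [| lra | lra]. nra. }
        rewrite I in U, L |- *; apply Rabs_le; unfold Rdiv in *; lra. }
      rewrite I in *; apply Rabs_le_inv in H, Hf; apply Rabs_le; lra.
Qed.

(** * Prefixes and compactness *)

Definition ext (s : bstring) : cantor := fun i => nth i s false.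

Lemma length_restr X n : length (restr X n) = n.
Proof. unfold restr; now rewrite length_map, length_seq. Qed.

Lemma restr_S X n : restr X (S n) = restr X n ++ [X n].
Proof. unfold restr; now rewrite seq_S, map_app. Qed.

Lemma nth_restr X n i : (i < n)%nat -> nth i (restr X n) false = X i.
Proof.
  intro Hi; unfold restr.
  rewrite (nth_indep _ false (X 0%nat)) by now rewrite length_map, length_seq.
  now rewrite map_nth, seq_nth.
Qed.

Lemma restr_eq X Y n : restr X n = restr Y n <-> forall i, (i < n)%nat -> X i = Y i.
Proof.
  split.
  - intros H i Hi; now rewrite <- (nth_restr X n), H, nth_restr.
  - intro H; apply map_ext_in; intros i Hi; apply in_seq in Hi; apply H; lia.
Qed.

Lemma restr_le X Y m n : (m <= n)%nat -> restr X n = restr Y n -> restr X m = restr Y m.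
Proof. rewrite !restr_eq; intros Hmn H i Hi; apply H; lia. Qed.

Lemma restr_app X m n : restr X (m + n) = restr X m ++ map X (seq m n).
Proof. unfold restr; now rewrite seq_app, map_app. Qed.

Lemma firstn_restr X m n : (m <= n)%nat -> firstn m (restr X n) = restr X m.
Proof.
  intro H; replace n with (m + (n - m))%nat by lia; rewrite restr_app.
  rewrite firstn_app, length_restr, Nat.sub_diag, firstn_O, app_nil_r.
  apply firstn_all2; now rewrite length_restr.
Qed.

Lemma is_prefix_restr s X : is_prefix s X <-> restr X (length s) = s.
Proof.
  split.
  - intro H; apply (nth_ext _ _ false false); [apply length_restr|].
    intros i Hi; rewrite length_restr in Hi; rewrite nth_restr by exact Hi.
    symmetry; now apply H.
  - intros H i Hi; rewrite <- H at 1; now apply nth_restr.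
Qed.

Lemma restr_ext s : restr (ext s) (length s) = s.
Proof. apply is_prefix_restr; intros i _; reflexivity. Qed.

Lemma restr_ext_firstn k s : (k <= length s)%nat -> restr (ext s) k = firstn k s.
Proof. intro H; rewrite <- (firstn_restr _ _ _ H), restr_ext; reflexivity. Qed.

Lemma firstn_snoc k (s : bstring) x :
  (k <= length s)%nat -> firstn k (s ++ [x]) = firstn k s.
Proof.
  intro H; rewrite firstn_app; replace (k - length s)%nat with 0%nat by lia.
  apply app_nil_r.
Qed.

(** Sequential compactness of Cantor space: a prefix shared by infinitely many terms has a one-bit
    extension that is shared by infinitely many. *)
Lemma accumulation_point (x : nat -> cantor) :
  exists X, forall k N, exists n, (N <= n)%nat /\ restr (x n) k = restr X k.
Proof.
  pose (freq (s : bstring) := forall N, exists n, (N <= n)%nat /\ restr (x n) (length s) = s).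
  pose (pre := fix pre k := match k with
    | O => []
    | S k => if excluded_middle_informative (freq (pre k ++ [false]))
             then pre k ++ [false] else pre k ++ [true] end).
  assert (Hlen : forall k, length (pre k) = k).
  { induction k as [|k IH]; simpl; [reflexivity|].
    destruct excluded_middle_informative; rewrite length_app, IH; simpl; lia. }
  assert (Hfreq : forall k, freq (pre k)).
  { induction k as [|k IH]; simpl; [intro N; exists N; split; [lia | reflexivity]|].
    destruct excluded_middle_informative as [|Hno]; [assumption|].
    (* If the [true] extension were absent from index [N] on, the [false] one would recur for
       ever. *)
    intro N; apply NNPP; intro HN; apply Hno; intro N'.
    destruct (IH (Nat.max N N')) as [n [Hn E]]; exists n; split; [lia|].
    rewrite length_app in HN |- *; rewrite Nat.add_1_r, restr_S, E.
    destruct (x n (length (pre k))) eqn:Ex; [|reflexivity].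
    exfalso; apply HN; exists n; split; [lia|].
    simpl; now rewrite Nat.add_1_r, restr_S, E, Ex. }
  exists (fun i => nth i (pre (S i)) false); intros k N.
  destruct (Hfreq k N) as [n [Hn E]]; exists n; split; [exact Hn|].
  rewrite Hlen in E; rewrite E; clear - Hlen.
  induction k as [|k IH]; [reflexivity|].
  rewrite restr_S, <- IH.
  assert (Hk : exists a, pre (S k) = pre k ++ [a])
    by (simpl; destruct excluded_middle_informative; eauto).
  destruct Hk as [a Ha]; rewrite Ha; do 2 f_equal.
  rewrite app_nth2 by (rewrite Hlen; lia).
  now rewrite Hlen, Nat.sub_diag.
Qed.


(** * The pulled-back measure *)

Section Functional.
Context (Phi : cantor -> cantor).

Definition cont (n L : nat) : Prop :=
  forall X Y, restr X L = restr Y L -> restr (Phi X) n = restr (Phi Y) n.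

(** Uniform continuity of the inverse of [Phi] on its image, stated without the inverse. *)
Definition sep (k n : nat) : Prop :=
  forall X Y, restr (Phi X) n = restr (Phi Y) n -> restr X k = restr Y k.

Definition out (n : nat) (s : bstring) : bstring := restr (Phi (ext s)) n.

Lemma cont_le n L n' L' : (n' <= n)%nat -> (L <= L')%nat -> cont n L -> cont n' L'.
Proof. intros Hn HL H X Y E; apply (restr_le _ _ n' n Hn), H, (restr_le _ _ _ _ HL E). Qed.

Lemma sep_le k n n' : (n <= n')%nat -> sep k n -> sep k n'.
Proof. intros Hn H X Y E; apply H, (restr_le _ _ _ _ Hn E). Qed.

Lemma out_snoc n L s x : cont n L -> (L <= length s)%nat -> out n (s ++ [x]) = out n s.
Proof.
  intros Hc Hs; apply Hc; rewrite !restr_ext_firstn; rewrite ?length_app; simpl; try lia.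
  now apply firstn_snoc.
Qed.

(** All points of the cylinder of [s] have the same first [length t] output bits, so testing the
    single point [ext s] suffices. *)
Lemma preimage_cyl_out t s L : cont (length t) L -> (L <= length s)%nat ->
  ((forall X, is_prefix s X -> preimage_cyl Phi t X) <-> out (length t) s = t).
Proof.
  intros Hc Hs; unfold preimage_cyl; split.
  - intro H; apply is_prefix_restr, H, is_prefix_restr, restr_ext.
  - intros H X HX; apply is_prefix_restr; apply is_prefix_restr in HX.
    rewrite <- H at 2; apply (cont_le _ _ _ _ (le_n _) Hs Hc).
    now rewrite HX, restr_ext.
Qed.

Lemma inner_approx_ssum A n : inner_approx A n =
  ssum n (fun s => if excluded_middle_informative (forall X, is_prefix s X -> A X)
                   then 1 else 0) / 2 ^ n.
Proof. unfold inner_approx; now rewrite fold_all_strings. Qed.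

Lemma is_prefix_snoc s x X : is_prefix (s ++ [x]) X -> is_prefix s X.
Proof.
  intros H i Hi; rewrite <- (H i) by (rewrite length_app; lia).
  now rewrite app_nth1.
Qed.

Lemma inner_approx_S A n : inner_approx A n <= inner_approx A (S n).
Proof.
  rewrite !inner_approx_ssum.
  set (f s := if excluded_middle_informative (forall X, is_prefix s X -> A X) then 1 else 0).
  replace (ssum n f / 2 ^ n) with (ssum n (fun s => 2 * f s) / 2 ^ S n)
    by (rewrite ssum_scal; simpl; pose proof (pow2_gt0 n); field; lra).
  apply Rmult_le_compat_r; [left; apply Rinv_0_lt_compat, pow2_gt0|].
  simpl; apply ssum_le; intros s _; unfold f.
  pose proof (fun x H X (P : is_prefix (s ++ [x]) X) => H X (is_prefix_snoc s x X P) : A X) as E.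
  repeat destruct excluded_middle_informative; try lra; exfalso; eauto.
Qed.

(** For clopen sets the supremum is attained, and uniqueness of least upper bounds pins down the
    value picked by [epsilon]. *)
Lemma mu_open_eq A v : (forall n, inner_approx A n <= v) ->
  (exists n, v = inner_approx A n) -> mu_open A = v.
Proof.
  intros Hub Hv.
  assert (Hlub : is_lub (fun x => exists n, x = inner_approx A n) v).
  { split; [intros x [n ->]; apply Hub | intros u Hu; now apply Hu]. }
  apply (is_lub_u (fun x => exists n, x = inner_approx A n)); [| exact Hlub].
  unfold mu_open; apply epsilon_spec; now exists v.
Qed.

(** The preimage is a union of cylinders of length [L], so the inner approximations are constant
    from [L] on; earlier ones are bounded by monotonicity. *)
Lemma mu_pre_ssum t L : cont (length t) L ->
  mu_pre Phi t = ssum L (fun s => if bs_eqb t (out (length t) s) then 1 else 0) / 2 ^ L.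
Proof.
  intro Hc.
  pose (v n := ssum n (fun s => if bs_eqb t (out (length t) s) then 1 else 0) / 2 ^ n).
  assert (Hv : forall n, (L <= n)%nat -> inner_approx (preimage_cyl Phi t) n = v n).
  { intros n Hn; rewrite inner_approx_ssum; unfold v; f_equal; apply ssum_ext; intros s Hs.
    pose proof (preimage_cyl_out t s L Hc ltac:(lia)) as E.
    destruct excluded_middle_informative as [H|H]; rewrite E in H;
      destruct (bs_eqb_spec t (out (length t) s)); congruence. }
  assert (HS : forall n, (L <= n)%nat -> v n = v L).
  { induction 1 as [|n Hn IH]; [reflexivity|]; rewrite <- IH; unfold v; simpl ssum.
    rewrite (ssum_ext n _ (fun s => 2 * (if bs_eqb t (out (length t) s) then 1 else 0))).
    - rewrite ssum_scal; simpl; pose proof (pow2_gt0 n); field; lra.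
    - intros s Hs; rewrite !(out_snoc _ L) by (assumption || lia); ring. }
  assert (Hmono : forall m n, (m <= n)%nat ->
    inner_approx (preimage_cyl Phi t) m <= inner_approx (preimage_cyl Phi t) n).
  { induction 1 as [|n Hn IH]; [apply Rle_refl|].
    eapply Rle_trans; [exact IH | apply inner_approx_S]. }
  apply mu_open_eq; [| exists L; symmetry; now apply Hv].
  intro n; eapply Rle_trans; [apply (Hmono n (Nat.max n L)); lia|].
  rewrite Hv, HS by lia; apply Rle_refl.
Qed.

End Functional.

(** * The savings strategy *)

Section Savings.
Context (b : bstring -> R) (e : bstring -> nat).
Hypothesis b_nonneg : forall t, 0 <= b t.
Hypothesis b_le : forall t, b t <= 2 ^ e t.
Hypothesis e_snoc : forall t x, (e t <= e (t ++ [x]))%nat.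
Hypothesis e_jump : forall t x,
  (e t < e (t ++ [x]))%nat -> 2 ^ e (t ++ [x]) <= 4 * b (t ++ [x]).

(** If the exponent rises with bit [i], the stake is cut after that bet is settled, and the amount
    released goes to the bank. *)
Definition bank_incr (t : bstring) (i : nat) : R :=
  b (firstn (S i) t) * (/ 2 ^ e (firstn i t) - / 2 ^ e (firstn (S i) t)).
Definition bank (t : bstring) : R := rsum (length t) (bank_incr t).
(* The capital of the gambler who always stakes the fraction [/ 2 ^ e t] of [b t]:
   since [2 ^ e] bounds [b] and never decreases, the part in [bank] is safe. *)
Definition sav (t : bstring) : R := b t / 2 ^ e t + bank t.

Lemma bank_snoc t x :
  bank (t ++ [x]) = bank t + b (t ++ [x]) * (/ 2 ^ e t - / 2 ^ e (t ++ [x])).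
Proof.
  unfold bank; rewrite length_app, Nat.add_1_r; simpl rsum; f_equal.
  - apply rsum_ext; intros i Hi; unfold bank_incr; now rewrite !firstn_snoc by lia.
  - unfold bank_incr; rewrite (firstn_snoc (length t)), firstn_all by lia.
    now rewrite firstn_all2 by (rewrite length_app; simpl; lia).
Qed.

(** The transfer to the bank cancels out. What remains is the gain of [b] times a factor fixed
    before the bet, so [sav] is fair wherever [b] is. *)
Lemma sav_snoc t x : sav (t ++ [x]) = sav t + (b (t ++ [x]) - b t) / 2 ^ e t.
Proof. unfold sav; rewrite bank_snoc; unfold Rdiv; ring. Qed.

Lemma inv_pow2_le m n : (m <= n)%nat -> / 2 ^ n <= / 2 ^ m.
Proof. intro H; apply Rinv_le_contravar; [apply pow2_gt0 | apply Rle_pow; lra || lia]. Qed.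

Lemma bank_snoc_le t x : bank t <= bank (t ++ [x]).
Proof.
  rewrite bank_snoc; pose proof (inv_pow2_le _ _ (e_snoc t x)).
  pose proof (b_nonneg (t ++ [x])); nra.
Qed.

Lemma bank_app_le t u : bank t <= bank (t ++ u).
Proof.
  induction u as [|x u IH] using rev_ind; [rewrite app_nil_r; lra|].
  rewrite app_assoc; eapply Rle_trans; [exact IH | apply bank_snoc_le].
Qed.

Lemma stake_bounds t : 0 <= b t / 2 ^ e t <= 1.
Proof.
  pose proof (pow2_gt0 (e t)) as P; pose proof (Rinv_0_lt_compat _ P).
  pose proof (b_nonneg t); pose proof (b_le t).
  split; [apply Rmult_le_pos; lra|].
  apply Rmult_le_reg_r with (2 ^ e t); [exact P|].
  unfold Rdiv; rewrite Rmult_assoc, Rinv_l by lra; lra.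
Qed.

Lemma sav_app_ge t u : bank t <= sav (t ++ u).
Proof. pose proof (bank_app_le t u); pose proof (stake_bounds (t ++ u)); unfold sav; lra. Qed.

Lemma sav_nonneg t : 0 <= sav t.
Proof.
  replace 0 with (bank []) by reflexivity; apply (sav_app_ge [] t).
Qed.

Lemma pow2_sub1_ge d : INR d <= 2 ^ d - 1.
Proof. induction d as [|d IH]; [simpl; lra|]; rewrite S_INR; simpl; pose proof (pos_INR d); lra. Qed.

(** When the exponent rises by [d], [e_jump] makes the transfer at least [(2^d - 1) / 4], hence at
    least [d / 4]. So the bank grows without bound along with [e]. *)
Lemma bank_lower t : INR (e t) <= INR (e []) + 4 * bank t.
Proof.
  induction t as [|x t IH] using rev_ind; [unfold bank; simpl; lra|].
  destruct (Nat.eq_dec (e t) (e (t ++ [x]))) as [E|E].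
  - rewrite <- E; pose proof (bank_snoc_le t x); lra.
  - assert (Hlt : (e t < e (t ++ [x]))%nat) by (pose proof (e_snoc t x); lia).
    pose proof (e_jump t x Hlt) as J; rewrite bank_snoc.
    remember (e (t ++ [x]) - e t)%nat as d eqn:Hd.
    replace (e (t ++ [x])) with (e t + d)%nat in J |- * by lia.
    rewrite plus_INR; rewrite pow_add in J |- *.
    pose proof (pow2_sub1_ge d); pose proof (pow2_gt0 (e t)); pose proof (pow2_gt0 d).
    assert (H3 : 2 ^ d - 1 <= 4 * (b (t ++ [x]) * (/ 2 ^ e t - / (2 ^ e t * 2 ^ d)))); [|lra].
    assert (H4 : / 2 ^ e t - / (2 ^ e t * 2 ^ d) = (2 ^ d - 1) / (2 ^ e t * 2 ^ d))
      by (field; lra).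
    rewrite H4; set (p := 2 ^ e t * 2 ^ d) in *.
    assert (0 < p) by (unfold p; nra).
    apply Rmult_le_reg_r with p; [assumption|].
    replace (4 * (b (t ++ [x]) * ((2 ^ d - 1) / p)) * p)
      with (4 * b (t ++ [x]) * (2 ^ d - 1)) by (field; lra).
    pose proof (pos_INR d); nra.
Qed.

End Savings.

(** * The pulled-back martingale *)

Section PullBack.
Context (Phi : cantor -> cantor) (b : bstring -> R) (e : bstring -> nat).
Context (Lm Nm : nat -> nat).
Hypothesis b_mart : Phi_martingale Phi b.
Hypothesis b_le : forall t, b t <= 2 ^ e t.
Hypothesis e_snoc : forall t x, (e t <= e (t ++ [x]))%nat.
Hypothesis e_jump : forall t x,
  (e t < e (t ++ [x]))%nat -> 2 ^ e (t ++ [x]) <= 4 * b (t ++ [x]).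
Hypothesis Lm_spec : forall n, (n <= Lm n)%nat /\ cont Phi n (Lm n).
Hypothesis Nm_spec : forall k, (k <= Nm k)%nat /\ sep Phi k (Nm k).

Notation out := (out Phi).
Notation sav := (sav b e).

Let b_nonneg t : 0 <= b t := proj1 b_mart t.

(* The conditional expectation of [sav (Phi X | n)] given that [X] extends [s],
   computed on the strings of length [L]. *)
Definition pull (n L : nat) (s : bstring) : R :=
  2 ^ length s / 2 ^ L *
  ssum L (fun u => if bs_eqb (firstn (length s) u) s then sav (out n u) else 0).

(** [Nm] makes [n] large enough for injectivity to act, and [Lm] makes the strings long enough to
    fix [n] output bits; by [pull_mart_eq] larger choices give the same value. *)
Definition pull_mart (s : bstring) : R := pull (Nm (length s)) (Lm (Nm (length s))) s.

Lemma pull_S n L s : cont Phi n L -> (length s <= L)%nat -> pull n (S L) s = pull n L s.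
Proof.
  intros Hc Hs; unfold pull; simpl ssum.
  rewrite (ssum_ext L _ (fun u => 2 *
    (if bs_eqb (firstn (length s) u) s then sav (out n u) else 0))).
  - rewrite ssum_scal; simpl; pose proof (pow2_gt0 L); field; lra.
  - intros u Hu; rewrite !firstn_snoc, !(out_snoc _ _ L) by (assumption || lia).
    destruct bs_eqb; ring.
Qed.

Lemma pull_le n L L' s : cont Phi n L -> (length s <= L)%nat -> (L <= L')%nat ->
  pull n L' s = pull n L s.
Proof.
  intros Hc Hs; induction 1 as [|L' HL IH]; [reflexivity|].
  rewrite pull_S; [exact IH | apply (cont_le _ n L); auto | lia].
Qed.

(** The equation for [b] read as a count: by [mu_pre_ssum] its measures are numbers of strings of
    length [L], up to a common factor. Nothing is divided by a measure, so null preimages are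
    covered. *)
Lemma fair_on_cylinder n L t : length t = n -> cont Phi (S n) L ->
  ssum L (fun u => if bs_eqb t (out n u) then b (out (S n) u) - b t else 0) = 0.
Proof.
  intros Ht Hc.
  pose (c t u := if bs_eqb t (out (length t) u) then 1 else 0).
  rewrite (ssum_ext L _ (fun u => b (t ++ [false]) * c (t ++ [false]) u +
    (b (t ++ [true]) * c (t ++ [true]) u + - b t * c t u))).
  - rewrite !ssum_plus, !ssum_scal.
    pose proof (proj2 b_mart t) as E.
    rewrite (mu_pre_ssum Phi t L), !(fun x => mu_pre_ssum Phi (t ++ [x]) L) in E.
    + pose proof (pow2_gt0 L); apply Rmult_eq_reg_r with (/ 2 ^ L);
        [| apply Rinv_neq_0_compat; lra].
      unfold Rdiv in E; unfold c; lra.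
    + now rewrite length_app, Nat.add_1_r, Ht.
    + now rewrite length_app, Nat.add_1_r, Ht.
    + apply (cont_le _ (S n) L); auto; lia.
  - intros u _; unfold c; rewrite !length_app, !Nat.add_1_r, Ht.
    replace (out (S n) u) with (out n u ++ [Phi (ext u) n]) by (symmetry; apply restr_S).
    rewrite !bs_eqb_snoc.
    destruct (bs_eqb_spec t (out n u)) as [<-|]; [|simpl; ring].
    destruct (Phi (ext u) n); simpl; ring.
Qed.

(* Injectivity enters here: once [Phi X | n] determines [X | length s], every
   cylinder of length [n] pulls back inside or outside the cylinder of [s]. *)
Lemma pull_succ n L s : cont Phi (S n) L -> sep Phi (length s) n -> (length s <= L)%nat ->
  pull (S n) L s = pull n L s.
Proof.
  intros Hc Hsep Hs; unfold pull; f_equal.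
  pose (h t u := if bs_eqb t (out n u) then b (out (S n) u) - b t else 0).
  pose (ind u := if bs_eqb (firstn (length s) u) s then 1 else 0).
  (* The gain at [u] is written as a sum over all [t] with a single nonzero term, so that the
     exchange of sums groups the gains by output cylinder. *)
  rewrite (ssum_ext L _ (fun u =>
    (if bs_eqb (firstn (length s) u) s then sav (out n u) else 0) +
    ssum n (fun t => if bs_eqb t (out n u)
      then ind u * / 2 ^ e (out n u) * h (out n u) u else 0))).
  2:{ intros u Hu; rewrite ssum_indicator by apply length_restr; unfold h, ind.
      destruct (bs_eqb_spec (out n u) (out n u)) as [_|Hn]; [|now elim Hn].
      destruct (bs_eqb (firstn (length s) u) s); [|ring].
      replace (out (S n) u) with (out n u ++ [Phi (ext u) n]) by (symmetry; apply restr_S).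
      rewrite sav_snoc; unfold Rdiv; ring. }
  rewrite ssum_plus, ssum_exchange.
  rewrite (ssum_ext n _ (fun _ => 0)), ssum_const; [ring|].
  intros t Ht.
  (* On the strings over [t] the weight [ind] equals its value at any one of them, so fairness on
     [t] applies; with no such string the sum is empty. *)
  destruct (excluded_middle_informative (exists v, length v = L /\ out n v = t))
    as [[v [Hv Ev]] | Hno].
  - rewrite (ssum_ext L _ (fun u => ind v * / 2 ^ e t * h t u)).
    + rewrite ssum_scal; unfold h; rewrite fair_on_cylinder by assumption; ring.
    + intros u Hu; unfold h; destruct (bs_eqb_spec t (out n u)) as [E|]; [|ring].
      rewrite <- E; destruct (bs_eqb_spec t t) as [_|Hn]; [|now elim Hn].
      replace (ind u) with (ind v); [reflexivity|].
      unfold ind; rewrite <- !restr_ext_firstn by lia.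
      rewrite (Hsep (ext v) (ext u)); [reflexivity | exact (eq_trans Ev E)].
  - rewrite (ssum_ext L _ (fun _ => 0)); [rewrite ssum_const; ring|].
    intros u Hu; destruct (bs_eqb_spec t (out n u)); [|reflexivity].
    exfalso; eauto.
Qed.

Lemma pull_mart_eq s n L : (Nm (length s) <= n)%nat -> cont Phi n L -> (length s <= L)%nat ->
  pull_mart s = pull n L s.
Proof.
  destruct (Nm_spec (length s)) as [N1 N2]; intro Hn; revert L.
  induction Hn as [|n Hn IH]; intros L Hc HL.
  - destruct (Lm_spec (Nm (length s))) as [L1 L2]; unfold pull_mart.
    destruct (Nat.le_ge_cases L (Lm (Nm (length s)))) as [H|H].
    + apply pull_le; assumption.
    + symmetry; apply pull_le; try assumption; lia.
  - rewrite pull_succ; [apply IH; auto | assumption | | assumption].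
    + apply (cont_le _ (S n) L); auto.
    + apply (sep_le _ _ (Nm (length s))); auto.
Qed.

Lemma firstn_S_snoc k (u : bstring) :
  (S k <= length u)%nat -> exists x, firstn (S k) u = firstn k u ++ [x].
Proof.
  revert u; induction k as [|k IH]; intros [|a u] H; simpl in H; try lia.
  - now exists a.
  - destruct (IH u) as [x Hx]; [lia|]; exists x; rewrite firstn_cons, Hx; reflexivity.
Qed.

Lemma pull_mart_martingale : martingale pull_mart.
Proof.
  split; intro s.
  - unfold pull_mart, pull; apply Rmult_le_pos.
    + left; apply Rmult_lt_0_compat; [|apply Rinv_0_lt_compat]; apply pow2_gt0.
    + apply ssum_nonneg; intros u _; destruct bs_eqb; [|lra].
      now apply sav_nonneg.
  (* The values at [s] and at its two extensions are compared on a common [n] and [Lm n]. *)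
  - pose (n := Nat.max (Nm (length s)) (Nm (S (length s)))).
    destruct (Lm_spec n) as [L1 L2], (Nm_spec (S (length s))) as [N1 _].
    rewrite !(fun t => pull_mart_eq t n (Lm n)); rewrite ?length_app, ?Nat.add_1_r;
      try assumption; try lia.
    unfold pull; rewrite !length_app, !Nat.add_1_r.
    transitivity (2 ^ S (length s) / 2 ^ Lm n * ssum (Lm n)
      (fun u => if bs_eqb (firstn (length s) u) s then sav (out n u) else 0));
      [| simpl; unfold Rdiv; ring].
    rewrite <- Rmult_plus_distr_l, <- ssum_plus; f_equal; apply ssum_ext; intros u Hu.
    destruct (firstn_S_snoc (length s) u) as [x ->]; [lia|].
    rewrite !bs_eqb_snoc; destruct bs_eqb, x; simpl; ring.
Qed.

(** The weights in [pull] add up to one; used for the lower bound by the bank and for the error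
    estimate. *)
Lemma ssum_prefix_const s L c : (length s <= L)%nat ->
  2 ^ length s / 2 ^ L * ssum L (fun u => if bs_eqb (firstn (length s) u) s then c else 0) = c.
Proof.
  induction 1 as [|L HL IH].
  - rewrite (ssum_ext _ _ (fun u => if bs_eqb u s then c else 0)).
    + rewrite ssum_indicator by reflexivity; pose proof (pow2_gt0 (length s)); field; lra.
    + intros u Hu; now rewrite firstn_all2 by lia.
  - simpl ssum; rewrite (ssum_ext L _ (fun u => 2 *
      (if bs_eqb (firstn (length s) u) s then c else 0))).
    + rewrite ssum_scal, <- IH at 1; simpl; pose proof (pow2_gt0 L); field; lra.
    + intros u Hu; rewrite !firstn_snoc by lia; ring.
Qed.

Lemma pull_mart_succeeds X : succeeds b (Phi X) -> succeeds pull_mart X.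
Proof.
  intros Hb M N.
  (* Chosen so that an exponent above [j] forces, by [bank_lower], a bank above [M]. *)
  destruct (INR_archimed 1 (INR (e []) + 4 * Rabs M + 4)) as [j Hj]; [lra|].
  destruct (Hb (2 ^ j) 0%nat) as [n0 [_ Hn0]].
  set (t := restr (Phi X) n0) in *.
  assert (HM : M < bank b e t).
  { assert (Hlt : (j < e t)%nat).
    { apply Nat.nle_gt; intro H; pose proof (b_le t).
      pose proof (Rle_pow 2 _ _ ltac:(lra) H); lra. }
    apply lt_INR in Hlt; pose proof (bank_lower b e b_nonneg e_snoc e_jump t).
    pose proof (Rle_abs M); lra. }
  destruct (Lm_spec n0) as [L1 L2].
  (* Beyond [Lm n0], every point that extends [restr X k] has an image extending [t], so its capital
     is at least the bank at [t]. *)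
  set (k := Nat.max N (Lm n0)); exists k; split; [unfold k; lia|].
  assert (Hk : length (restr X k) = k) by apply length_restr.
  destruct (Nm_spec k) as [N1 N2], (Lm_spec (Nm k)) as [L3 L4].
  rewrite (pull_mart_eq _ (Nm k) (Lm (Nm k))) by (rewrite ?Hk; assumption || lia).
  apply Rlt_le_trans with (1 := HM).
  rewrite <- (ssum_prefix_const (restr X k) (Lm (Nm k)) (bank b e t)) by (rewrite Hk; lia).
  apply Rmult_le_compat_l.
  { left; apply Rmult_lt_0_compat; [|apply Rinv_0_lt_compat]; apply pow2_gt0. }
  apply ssum_le; intros u Hu; rewrite Hk.
  destruct (bs_eqb_spec (firstn k u) (restr X k)) as [E|]; [|lra].
  assert (Ht : restr (Phi (ext u)) n0 = t).
  { apply L2, (restr_le _ _ _ k); [unfold k; lia|].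
    rewrite restr_ext_firstn by lia; exact E. }
  unfold out; replace (Nm k) with (n0 + (Nm k - n0))%nat by (unfold k in *; lia).
  rewrite restr_app, Ht; now apply sav_app_ge.
Qed.

End PullBack.

(** * Moduli and computability of the pull-back *)

(** [out] evaluates [Phi] on an infinite sequence; [og n] is its computable counterpart on strings
    of length [Lm n]. *)
Definition computable_modulus (Phi : cantor -> cantor) (Lm : nat -> nat)
    (og : nat -> bstring -> bstring) : Prop :=
  Comp Lm /\ Comp (fun p => og (fst p) (snd p)) /\
  forall n, (n <= Lm n)%nat /\ forall X, restr (Phi X) n = og n (restr X (Lm n)).

Lemma computable_modulus_cont Phi Lm og n : computable_modulus Phi Lm og -> cont Phi n (Lm n).
Proof. intros (_ & _ & H) X Y E; destruct (H n) as [_ Hn]; now rewrite !Hn, E. Qed.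

(** If at every length [L >= n] some string left [g] with fewer than [n] bits, these strings would
    accumulate at some [X]; but [g] yields [n] bits on a prefix of [X]. *)
Lemma computable_modulus_exists Phi :
  computable_functional Phi -> exists Lm og, computable_modulus Phi Lm og.
Proof.
  intros (g & Hg & Hspec); change (Comp g) in Hg.
  (* Outputs of [g] may get shorter on longer prefixes, so the first prefix of [s] with [n] output
     bits is used. The bound by the length of [s] ends the search. *)
  destruct (Comp_min (fun (p : nat * bstring) j =>
      orb (Nat.leb (fst p) (length (g (firstn j (snd p))))) (Nat.leb (length (snd p)) j)))
    as [jn [Hjn [J1 J2]]].
  { comp. }
  { intros [n s]; exists (length s); simpl; now rewrite Nat.leb_refl, orb_true_r. }
  pose (w n s := g (firstn (jn (n, s)) s)).
  assert (Hw : Comp (fun p => w (fst p) (snd p))) by (unfold w; comp).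
  destruct (Comp_min (fun n L => andb (Nat.leb n L) (sball L (fun s => Nat.leb n (length (w n s))))))
    as [Lm [HLm [M1 _]]].
  { apply Comp_andb; [comp|].
    apply (Comp_sball (fun p : nat * nat => snd p)
             (fun p s => Nat.leb (fst p) (length (w (fst p) s)))); comp. }
  { intro n; apply NNPP; intro Hno.
    assert (Hbad : forall L, exists s : bstring, (n <= L)%nat -> length s = L /\ (length (w n s) < n)%nat).
    { intro L; apply NNPP; intro Hs; apply Hno; exists L.
      destruct (Nat.leb_spec n L) as [HnL|HnL]; simpl.
      - apply sball_spec; intros s Hl; apply Nat.leb_le, Nat.nlt_ge; intro Hlt.
        apply Hs; now exists s.
      - exfalso; apply Hs; exists []; intro; lia. }
    destruct (choice _ Hbad) as [s Hs].
    destruct (accumulation_point (fun L => ext (s L))) as [X HX].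
    destruct (proj2 (Hspec X) n) as [m Hm].
    destruct (HX m (Nat.max n m)) as [L [HL E]].
    destruct (Hs L) as [Hlen Hlt]; [lia|].
    rewrite restr_ext_firstn in E by lia; rewrite <- E in Hm.
    assert (Hj : (jn (n, s L) <= m)%nat)
      by (apply J2; simpl; now rewrite (proj2 (Nat.leb_le _ _) Hm)).
    specialize (J1 (n, s L)); simpl in J1; apply orb_prop in J1; unfold w in Hlt.
    destruct J1 as [J1|J1]; apply Nat.leb_le in J1.
    - exact (Nat.lt_irrefl _ (Nat.lt_le_trans _ _ _ Hlt J1)).
    - rewrite Hlen in J1; replace (jn (n, s L)) with m in Hlt by lia.
      exact (Nat.lt_irrefl _ (Nat.lt_le_trans _ _ _ Hlt Hm)). }
  exists Lm, (fun n s => firstn n (w n s)); split; [exact HLm|]; split; [comp|].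
  intro n; specialize (M1 n); apply andb_prop in M1 as [M1 M2].
  apply Nat.leb_le in M1; split; [exact M1|]; intro X.
  rewrite sball_spec in M2; specialize (M2 _ (length_restr X (Lm n))).
  apply Nat.leb_le in M2; unfold w in *.
  set (j := jn (n, restr X (Lm n))) in *.
  assert (Ej : firstn j (restr X (Lm n)) = restr X (Nat.min j (Lm n))).
  { destruct (Nat.le_ge_cases j (Lm n)).
    - rewrite Nat.min_l by assumption; now apply firstn_restr.
    - rewrite Nat.min_r by assumption; apply firstn_all2; now rewrite length_restr. }
  rewrite Ej in *.
  pose proof (proj1 (Hspec X) (Nat.min j (Lm n))) as Hp; apply is_prefix_restr in Hp.
  rewrite <- Hp; symmetry; now apply firstn_restr.
Qed.

(** Codes two sequences as one, so that a single accumulation point serves both. *)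
Definition interleave (X Y : cantor) : cantor :=
  fun i => if Nat.even i then X (Nat.div2 i) else Y (Nat.div2 i).

(** Otherwise pairs that differ below [k], with images agreeing up to [n], accumulate at a pair with
    equal images. By injectivity its members coincide, so nearby pairs agree below [k]. *)
Lemma injectivity_modulus Phi k : (forall n, exists L, cont Phi n L) ->
  injective_functional Phi -> exists n, (k <= n)%nat /\ sep Phi k n.
Proof.
  intros Hc Hinj; apply NNPP; intro Hno.
  assert (Hbad : forall n, exists p : cantor * cantor, (k <= n)%nat ->
    restr (Phi (fst p)) n = restr (Phi (snd p)) n /\ restr (fst p) k <> restr (snd p) k).
  { intro n; apply NNPP; intro H; apply Hno; exists n; split.
    - apply Nat.nlt_ge; intro Hlt; apply H; exists (ext [], ext []); intro; lia.
    - intros X Y E; apply NNPP; intro HXY; apply H; now exists (X, Y). }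
  destruct (choice _ Hbad) as [x Hx].
  destruct (accumulation_point (fun n => interleave (fst (x n)) (snd (x n)))) as [Z HZ].
  pose (X i := Z (2 * i)%nat); pose (Y i := Z (2 * i + 1)%nat).
  assert (HXY : forall L N, exists n, (N <= n)%nat /\
    restr (fst (x n)) L = restr X L /\ restr (snd (x n)) L = restr Y L).
  { intros L N; destruct (HZ (2 * L)%nat N) as [n [Hn E]]; exists n; split; [exact Hn|].
    rewrite !restr_eq in *; split; intros i Hi.
    - unfold X; rewrite <- E by lia; unfold interleave.
      now rewrite Nat.even_even, Nat.div2_double.
    - unfold Y; rewrite <- E by lia; unfold interleave.
      rewrite Nat.add_1_r, Nat.div2_succ_double, Nat.even_succ, <- Nat.negb_even.
      now rewrite Nat.even_even. }
  assert (E : forall i, X i = Y i).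
  { apply Hinj; intro m; destruct (Hc (S m)) as [L HL].
    destruct (HXY L (Nat.max k (S m))) as [n [Hn [EX EY]]].
    destruct (Hx n) as [Hxn _]; [lia|].
    apply (restr_le _ _ (S m)) in Hxn; [|lia].
    rewrite (HL _ _ EX), (HL _ _ EY), restr_eq in Hxn; apply Hxn; lia. }
  destruct (HXY k k) as [n [Hn [EX EY]]].
  destruct (Hx n Hn) as [_ Hne]; apply Hne; rewrite EX, EY; apply restr_eq; auto.
Qed.

(** Through [og], separation becomes a check of finitely many pairs of strings of length [Lm n], so
    the search applies. *)
Lemma computable_injectivity_modulus Phi Lm og :
  computable_modulus Phi Lm og -> injective_functional Phi ->
  exists Nm, Comp Nm /\ forall k, (k <= Nm k)%nat /\ sep Phi k (Nm k).
Proof.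
  intros HM Hinj; pose proof (fun n => computable_modulus_cont _ _ _ n HM) as Hc.
  destruct HM as (HLm & Hog & Hspec).
  destruct (Comp_min (fun k n => andb (Nat.leb k n) (sball (Lm n) (fun s =>
      sball (Lm n) (fun t => orb (negb (bs_eqb (og n s) (og n t)))
                                 (bs_eqb (firstn k s) (firstn k t)))))))
    as [Nm [HNm [N1 _]]].
  { apply Comp_andb; [comp|].
    apply (Comp_sball (fun p : nat * nat => Lm (snd p)) (fun p s =>
      sball (Lm (snd p)) (fun t => orb (negb (bs_eqb (og (snd p) s) (og (snd p) t)))
                                 (bs_eqb (firstn (fst p) s) (firstn (fst p) t))))); [comp|].
    apply (Comp_sball (fun p : (nat * nat) * bstring => Lm (snd (fst p))) (fun p t =>
      orb (negb (bs_eqb (og (snd (fst p)) (snd p)) (og (snd (fst p)) t)))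
          (bs_eqb (firstn (fst (fst p)) (snd p)) (firstn (fst (fst p)) t)))); comp. }
  { intro k; destruct (injectivity_modulus Phi k) as [n [Hn Hsep]]; [eauto | exact Hinj |].
    exists n; apply andb_true_intro; split; [now apply Nat.leb_le|].
    destruct (Hspec n) as [L1 L2].
    apply sball_spec; intros s Hs; apply sball_spec; intros t Ht.
    destruct (bs_eqb_spec (og n s) (og n t)) as [E|]; [simpl|reflexivity].
    destruct (bs_eqb_spec (firstn k s) (firstn k t)) as [|Hne]; [reflexivity|].
    elim Hne; rewrite <- !restr_ext_firstn by lia; apply Hsep; rewrite !L2.
    pose proof (restr_ext s) as Es; pose proof (restr_ext t) as Et.
    rewrite Hs in Es; rewrite Ht in Et; now rewrite Es, Et. }
  exists Nm; split; [exact HNm|]; intro k; specialize (N1 k).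
  apply andb_prop in N1 as [N1 N2]; apply Nat.leb_le in N1; split; [exact N1|].
  destruct (Hspec (Nm k)) as [L1 L2]; intros X Y E; rewrite !L2 in E.
  rewrite sball_spec in N2; specialize (N2 _ (length_restr X _)).
  rewrite sball_spec in N2; specialize (N2 _ (length_restr Y _)).
  destruct (bs_eqb_spec (og (Nm k) (restr X (Lm (Nm k)))) (og (Nm k) (restr Y (Lm (Nm k)))))
    as [_|]; [simpl in N2 | contradiction].
  rewrite !firstn_restr in N2 by lia.
  destruct (bs_eqb_spec (restr X k) (restr Y k)); [assumption | discriminate].
Qed.

Lemma savings_level b beta :
  (forall t, 0 <= b t) ->
  Comp (fun p => beta (fst p) (snd p)) ->
  (forall t k, Rabs (b t - INR (beta t k) / 2 ^ k) <= / 2 ^ k) ->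
  exists e : bstring -> nat, Comp e /\ (forall t, b t <= 2 ^ e t) /\
    (forall t x, (e t <= e (t ++ [x]))%nat) /\
    (forall t x, (e t < e (t ++ [x]))%nat -> 2 ^ e (t ++ [x]) <= 4 * b (t ++ [x])).
Proof.
  intros Hb Hbeta Happ.
  assert (B : forall t, INR (beta t 0%nat) <= b t + 1 /\ b t <= INR (beta t 0%nat) + 1).
  { intro t; specialize (Happ t 0%nat); apply Rabs_le_inv in Happ; simpl in Happ.
    rewrite Rinv_1, Rdiv_1_r in Happ; lra. }
  (* Comparing the real [b t] with a power of two is undecidable, so an approximation with error 1
     is compared. Ranging over all prefixes makes [e] monotone; the floor 3 ensures [2^d >= 8] at a
     jump to [S d], which absorbs the error. *)
  destruct (Comp_min (fun t j => andb (Nat.leb 3 j)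
      (ball (S (length t)) (fun i => Nat.leb (beta (firstn i t) 0%nat + 1) (2 ^ j)))))
    as [e [He [E1 E2]]].
  { apply Comp_andb; [comp|].
    apply (Comp_ball (fun p : bstring * nat => S (length (fst p)))
      (fun p i => Nat.leb (beta (firstn i (fst p)) 0%nat + 1) (2 ^ snd p))); comp. }
  { intro t.
    assert (H : forall n, exists m, forall i, (i < n)%nat -> (beta (firstn i t) 0%nat <= m)%nat).
    { induction n as [|n [m IH]]; [exists 0%nat; lia|].
      exists (Nat.max m (beta (firstn n t) 0%nat)); intros i Hi.
      destruct (Nat.eq_dec i n) as [->|]; [lia|]; specialize (IH i); lia. }
    destruct (H (S (length t))) as [m Hm]; exists (m + 3)%nat.
    apply andb_true_intro; split; [apply Nat.leb_le; lia|].
    apply ball_spec; intros i Hi; apply Nat.leb_le; specialize (Hm i Hi).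
    pose proof (Nat.pow_gt_lin_r 2 (m + 3)); lia. }
  assert (F : forall t, (3 <= e t)%nat /\
    forall i, (i <= length t)%nat -> (beta (firstn i t) 0%nat + 1 <= 2 ^ e t)%nat).
  { intro t; specialize (E1 t); apply andb_prop in E1 as [H1 H2].
    apply Nat.leb_le in H1; split; [exact H1|]; intros i Hi.
    rewrite ball_spec in H2; apply Nat.leb_le, H2; lia. }
  exists e; split; [exact He|]; split; [|split].
  - intro t; destruct (F t) as [_ H]; specialize (H (length t) (le_n _)).
    rewrite firstn_all in H; apply le_INR in H; rewrite INR_pow2, plus_INR in H.
    simpl in H; destruct (B t); lra.
  - intros t x; apply E2; destruct (F (t ++ [x])) as [H1 H2].
    apply andb_true_intro; split; [now apply Nat.leb_le|].
    apply ball_spec; intros i Hi; apply Nat.leb_le.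
    rewrite <- (firstn_snoc i t x) by lia; apply H2; rewrite length_app; lia.
  - intros t x Hlt; destruct (F t) as [T1 T2].
    destruct (e (t ++ [x])) as [|d] eqn:Ed; [lia|].
    (* The proper prefixes already pass at [e t <= d], so only the full string can have forced the
       jump. *)
    assert (Hd : (2 ^ d < beta (t ++ [x]) 0%nat + 1)%nat).
    { apply Nat.nle_gt; intro Hle.
      assert (e (t ++ [x]) <= d)%nat; [|lia].
      apply E2, andb_true_intro; split; [apply Nat.leb_le; lia|].
      apply ball_spec; intros i Hi; apply Nat.leb_le.
      rewrite length_app in Hi; simpl in Hi.
      destruct (Nat.eq_dec i (length t + 1)) as [->|].
      - rewrite firstn_all2; [exact Hle | rewrite length_app; simpl; lia].
      - rewrite firstn_snoc by lia; eapply Nat.le_trans; [apply T2; lia|].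
        apply Nat.pow_le_mono_r; lia. }
    assert (H8 : (2 ^ 3 <= 2 ^ d)%nat) by (apply Nat.pow_le_mono_r; lia).
    apply lt_INR in Hd; apply le_INR in H8; rewrite !INR_pow2 in *; rewrite plus_INR in Hd.
    destruct (B (t ++ [x])); simpl in *; lra.
Qed.

Lemma DC_sav beta e : Comp (fun p => beta (fst p) (snd p)) -> Comp e ->
  (forall t x, (e t <= e (t ++ [x]))%nat) ->
  DC (fun p : bstring * nat => sav (fun t => INR (beta t (snd p)) / 2 ^ snd p) e (fst p)).
Proof.
  intros Hbeta He Hmono; unfold sav, bank.
  apply (DC_add (fun p : bstring * nat => INR (beta (fst p) (snd p)) / 2 ^ snd p / 2 ^ e (fst p))
    (fun p : bstring * nat => rsum (length (fst p))
      (bank_incr (fun t => INR (beta t (snd p)) / 2 ^ snd p) e (fst p)))).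
  - apply DC_div_pow2; [|comp].
    apply (DC_div_pow2 (fun p : bstring * nat => INR (beta (fst p) (snd p)))); [|comp].
    apply DC_nat; exact Hbeta.
  (* The two fractions are put over the larger power of two; since [e] is monotone, the truncated
     subtractions are exact. *)
  - pose (f (p : bstring * nat) (i : nat) :=
      INR (beta (firstn (S i) (fst p)) (snd p)
           * (2 ^ (e (firstn (S i) (fst p)) - e (firstn i (fst p))) - 1))
      / 2 ^ (snd p + e (firstn (S i) (fst p)))).
    apply (DC_ext (fun p => rsum (length (fst p)) (f p))).
    + intros [t k]; simpl fst; simpl snd; apply rsum_ext; intros i Hi.
      unfold f, bank_incr; simpl fst; simpl snd.
      destruct (firstn_S_snoc i t) as [x Hx]; [lia|].
      pose proof (Hmono (firstn i t) x) as Hle; rewrite <- Hx in Hle.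
      pose proof (pow2_pos (e (firstn (S i) t) - e (firstn i t))).
      set (d := (e (firstn (S i) t) - e (firstn i t))%nat) in *.
      rewrite mult_INR, minus_INR, INR_pow2 by lia.
      replace (e (firstn (S i) t)) with (e (firstn i t) + d)%nat by lia.
      rewrite !pow_add; pose proof (pow2_gt0 (e (firstn i t))); pose proof (pow2_gt0 d).
      pose proof (pow2_gt0 k); simpl INR; field; lra.
    + apply DC_rsum; [comp|]; unfold f.
      apply (DC_div_pow2 (fun p : (bstring * nat) * nat =>
        INR (beta (firstn (S (snd p)) (fst (fst p))) (snd (fst p))
           * (2 ^ (e (firstn (S (snd p)) (fst (fst p))) - e (firstn (snd p) (fst (fst p)))) - 1)))
        (fun p => (snd (fst p) + e (firstn (S (snd p)) (fst (fst p))))%nat)); [|comp].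
      apply DC_nat; comp.
Qed.

(** [sav] is linear in [b] with nonnegative weights: those of the bank telescope to at most
    [1 - / 2^e t], and the stake has weight [/ 2^e t]. *)
Lemma sav_approx b c e d t : (forall t x, (e t <= e (t ++ [x]))%nat) ->
  (forall t, Rabs (b t - c t) <= d) -> Rabs (sav b e t - sav c e t) <= d.
Proof.
  intros Hmono Hd.
  assert (D : forall t, - d <= b t - c t <= d) by (intro; apply Rabs_le_inv, Hd).
  assert (H : Rabs (bank b e t - bank c e t) <= d * (1 - / 2 ^ e t)).
  { induction t as [|x t IH] using rev_ind.
    - unfold bank; simpl; rewrite Rminus_diag, Rabs_R0.
      pose proof (inv_pow2_le 0 (e []) ltac:(lia)); simpl in *; rewrite Rinv_1 in *.
      specialize (D []); apply Rmult_le_pos; lra.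
    - rewrite !bank_snoc; apply Rabs_le_inv in IH; apply Rabs_le.
      pose proof (inv_pow2_le _ _ (Hmono t x)); specialize (D (t ++ [x])); nra. }
  apply Rabs_le_inv in H; apply Rabs_le; unfold sav, Rdiv.
  pose proof (Rinv_0_lt_compat _ (pow2_gt0 (e t))); specialize (D t); nra.
Qed.

Lemma pull_approx Phi b c e d n L s : (forall t x, (e t <= e (t ++ [x]))%nat) ->
  (forall t, Rabs (b t - c t) <= d) -> (length s <= L)%nat ->
  Rabs (pull Phi b e n L s - pull Phi c e n L s) <= d.
Proof.
  intros Hmono Hd HL.
  assert (A : forall a r, (forall t, Rabs (a t - r t) <= d) ->
    pull Phi a e n L s <= pull Phi r e n L s + d).
  { intros a r Har; unfold pull; rewrite <- (ssum_prefix_const s L d HL).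
    rewrite <- Rmult_plus_distr_l, <- ssum_plus; apply Rmult_le_compat_l.
    - left; apply Rmult_lt_0_compat; [|apply Rinv_0_lt_compat]; apply pow2_gt0.
    - apply ssum_le; intros u _; destruct bs_eqb; [|lra].
      pose proof (sav_approx a r e d (out Phi n u) Hmono Har) as H.
      apply Rabs_le_inv in H; lra. }
  pose proof (A b c Hd); pose proof (A c b) as A2.
  apply Rabs_le; split; [|lra].
  specialize (A2 (fun t => eq_ind_r (fun x => x <= d) (Hd t) (Rabs_minus_sym _ _))); lra.
Qed.

Lemma pull_mart_computable Phi Lm og Nm b beta e :
  computable_modulus Phi Lm og ->
  Comp Nm -> (forall k, (k <= Nm k)%nat) ->
  Comp (fun p => beta (fst p) (snd p)) ->
  (forall t k, Rabs (b t - INR (beta t k) / 2 ^ k) <= / 2 ^ k) ->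
  Comp e -> (forall t x, (e t <= e (t ++ [x]))%nat) ->
  computable_real_fun (pull_mart Phi b e Lm Nm).
Proof.
  intros (HLm & Hog & Hspec) HNm Nle Hbeta Happ He Hmono.
  pose (n (s : bstring) := Nm (length s)).
  assert (Hn : Comp n) by (unfold n; comp).
  apply (computable_real_intro _
    (fun s k => pull Phi (fun t => INR (beta t k) / 2 ^ k) e (n s) (Lm (n s)) s)).
  - apply (DC_ext (fun p : bstring * nat =>
      2 ^ length (fst p) / 2 ^ Lm (n (fst p)) * ssum (Lm (n (fst p))) (fun u =>
        if bs_eqb (firstn (length (fst p)) u) (fst p)
        then sav (fun t => INR (beta t (snd p)) / 2 ^ snd p) e (og (n (fst p)) u) else 0))).
    + intros [s k]; unfold pull; simpl fst; simpl snd; f_equal; apply ssum_ext; intros u Hu.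
      destruct (Hspec (n s)) as [_ E]; unfold out; now rewrite E, <- Hu, restr_ext.
    + apply DC_mul.
      * apply (DC_div_pow2 (fun p : bstring * nat => 2 ^ length (fst p))); [|comp].
        apply DC_pow2; comp.
      * apply DC_ssum; [comp|].
        apply (DC_if (fun p : (bstring * nat) * bstring =>
          bs_eqb (firstn (length (fst (fst p))) (snd p)) (fst (fst p)))); [comp | |].
        -- apply (DC_comp (fun p : bstring * nat =>
             sav (fun t => INR (beta t (snd p)) / 2 ^ snd p) e (fst p))
             (fun p : (bstring * nat) * bstring => (og (n (fst (fst p))) (snd p), snd (fst p))));
             [now apply DC_sav | comp].
        -- apply (DC_nat (fun _ => 0%nat)); comp.
  - intros s k; apply pull_approx; [exact Hmono | intro; apply Happ |].
    destruct (Hspec (n s)); specialize (Nle (length s)); unfold n in *; lia.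
Qed.

Theorem mainTheorem5 (Phi : cantor -> cantor) :
  computable_functional Phi ->
  injective_functional Phi ->
  forall X : cantor, computably_random X ->
  computably_random_wrt Phi (Phi X).
Proof.
  intros Hcomp Hinj X HX b Hb Hbc Hsucc.
  destruct (computable_modulus_exists Phi Hcomp) as (Lm & og & HM).
  destruct (computable_injectivity_modulus Phi Lm og HM Hinj) as (Nm & HNm & HN).
  destruct (computable_real_approx b (proj1 Hb) Hbc) as (beta & Hbeta & Happ).
  destruct (savings_level b beta (proj1 Hb) Hbeta Happ) as (e & He & E1 & E2 & E3).
  assert (HL : forall n, (n <= Lm n)%nat /\ cont Phi n (Lm n)).
  { intro n; split; [apply HM | exact (computable_modulus_cont _ _ _ n HM)]. }
  apply (HX (pull_mart Phi b e Lm Nm)).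
  - now apply pull_mart_martingale.
  - apply (pull_mart_computable Phi Lm og Nm b beta e); auto; apply HN.
  - now apply pull_mart_succeeds.
Qed.
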